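(* Let $M$ be a smooth oriented manifold of dimension $n\geq2$ with a projective structure represented by a special torsion-free connection $\nabla_a$, with Schouten tensor $\mathrm{P}_{ab}$, Weyl curvature $W_{ab}{}^c{}_d$ and Cotton-York tensor $Y_{abc}$. The sections $\sigma^{bc}$ of $\mathcal{E}^{(bc)}(-2)$ satisfying $$\nabla_a\sigma^{bc}=\delta_a{}^b\mu^c+\delta_a{}^c\mu^b\quad\text{for some }\mu^a$$ are in one-to-one correspondence, via $(\sigma^{bc},\mu^b,\rho)\mapsto\sigma^{bc}$, with the sections $(\sigma^{bc},\mu^b,\rho)$ of the tractor bundle $\mathcal{E}^{(BC)}$ satisfying $$\nabla_a\begin{pmatrix}\sigma^{bc}\\ \mu^b\\ \rho\end{pmatrix}-\frac1n\begin{pmatrix}0\\ W_{ac}{}^b{}_d\sigma^{cd}\\ 4Y_{abc}\sigma^{bc}\end{pmatrix}=0,$$ where $\nabla_a$ acting on the column is the tractor connection on $\mathcal{E}^{(BC)}$.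
   Context: Abstract index notation is used; $\delta_a{}^b$ is the identity endomorphism; all objects are smooth. Two torsion-free connections are projectively equivalent if they have the same unparameterised geodesics; equivalently $\hat\nabla_aX^b=\nabla_aX^b+\Upsilon_aX^b+\delta_a{}^b\Upsilon_cX^c$ for some $1$-form $\Upsilon_a$. A projective structure is a projective equivalence class. A torsion-free connection is special if it preserves some volume form $\epsilon_{bc\cdots d}$; special connections in the same class are related by $\Upsilon_a=\nabla_af$ for a smooth function $f$, and then $\hat\nabla$ preserves $\hat\epsilon_{bc\cdots d}=e^{(n+1)f}\epsilon_{bc\cdots d}$. A special connection has symmetric Ricci tensor $R_{ab}$, where $(\nabla_b\nabla_a-\nabla_a\nabla_b)X^b=R_{ab}X^b$. Put $\mathrm{P}_{ab}=\frac1{n-1}R_{ab}$ (Schouten tensor). The Weyl curvature $W_{ab}{}^c{}_d$ is the totally trace-free tensor defined by $(\nabla_a\nabla_b-\nabla_b\nabla_a)X^c=W_{ab}{}^c{}_dX^d+\delta_a{}^c\mathrm{P}_{bd}X^d-\delta_b{}^c\mathrm{P}_{ad}X^d$, and $Y_{abc}=\frac12(\nabla_a\mathrm{P}_{bc}-\nabla_b\mathrm{P}_{ac})$ (Cotton-York tensor). Projective weights: a tensor bundle of weight $w$ is the tensor bundle tensored with $(\Lambda^n)^{-w/(n+1)}$, where $\Lambda^n$ is the bundle of $n$-forms. Thus, given a volume form, a section is an ordinary tensor, and under $\hat\epsilon=e^{(n+1)f}\epsilon$ it is rescaled by $e^{wf}$. $\mathcal{E}^{(bc)}(-2)$, $\mathcal{E}^b(-2)$,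 $\mathcal{E}(-2)$ are the bundles of symmetric contravariant $2$-tensors, vectors, and functions of weight $-2$. When $\nabla$ preserves $\epsilon$, using $\epsilon$ to identify weighted with ordinary tensors is compatible with $\nabla$. The tractor bundle $\mathcal{E}^{(BC)}$ (induced by the representation $\bigodot^2\mathbb{R}^{n+1}$ of $\mathrm{SL}(n+1,\mathbb{R})$ and the Cartan connection of the projective structure) is, for each special connection $\nabla$ in the class, identified with the direct sum $\mathcal{E}^{(bc)}(-2)\oplus\mathcal{E}^b(-2)\oplus\mathcal{E}(-2)$. Under change of connection with $1$-form $\Upsilon_a$, the representing triple $(\sigma^{bc},\mu^b,\rho)$ (of weighted tensors) is replaced by $(\sigma^{bc},\ \mu^b+\Upsilon_c\sigma^{bc},\ \rho+2\Upsilon_b\mu^b+\Upsilon_b\Upsilon_c\sigma^{bc})$. The tractor connection is $$\nabla_a\begin{pmatrix}\sigma^{bc}\\ \mu^b\\ \rho\end{pmatrix}=\begin{pmatrix}\nabla_a\sigma^{bc}-\delta_a{}^b\mu^c-\delta_a{}^c\mu^b\\ \nabla_a\mu^b-\delta_a{}^b\rho+\mathrm{P}_{ac}\sigma^{bc}\\ \nabla_a\rho+2\mathrm{P}_{ab}\mu^b\end{pmatrix}.$$ *)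

(* Defs.v *)
From HB Require Import structures.
From mathcomp Require Import all_boot all_order all_algebra.
From mathcomp Require Import all_classical all_reals all_analysis.

Set Implicit Arguments.
Unset Strict Implicit.
Unset Printing Implicit Defensive.

Import Order.TTheory GRing.Theory Num.Theory numFieldNormedType.Exports.

Local Open Scope classical_set_scope.
Local Open Scope ring_scope.

(* Tensor calculus on an oriented manifold, in components.

   A field on M is a family, indexed by the charts i of an oriented atlas, of
   component functions on R^n, of which only the values on the image of the
   chart i are meaningful; they are tied together by the usual transformation
   law on overlaps.  So that equality of fields is equality of functions, the
   component functions are required to vanish outside the chart image. *)

Section LocalCalculus.
Context {R : realType} {n : nat}.
Local Notation V := 'rV[R]_n.

Definition delta (a b : 'I_n) : R := (a == b)%:R.

Definition pd (a : 'I_n) (f : V -> R) : V -> R :=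
  fun x => 'D_(delta_mx 0 a) f x.

Fixpoint diff_upto (k : nat) (U : set V) (f : V -> R) : Prop :=
  if k is k'.+1 then
    (forall x, U x -> differentiable f x) /\
    (forall a, diff_upto k' U (pd a f))
  else True.

Definition smooth_on (U : set V) (f : V -> R) : Prop :=
  forall k, diff_upto k U f.

(* G a b c is the Christoffel symbol with lower indices a, b (a being the
   direction of differentiation) and upper index c. *)
Definition christoffel := 'I_n -> 'I_n -> 'I_n -> V -> R.

Section Christoffel.
Variable G : christoffel.

(* nabla_a X^b *)
Definition nabla_vec (X : 'I_n -> V -> R) (a b : 'I_n) (x : V) : R :=
  pd a (X b) x + \sum_c G a c b x * X c x.

(* nabla_a T_b^c *)
Definition nabla_mixed (T : 'I_n -> 'I_n -> V -> R) (a b c : 'I_n) (x : V) : R :=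
  pd a (T b c) x - \sum_d G a b d x * T d c x + \sum_d G a d c x * T b d x.

(* nabla_a T_{bc} *)
Definition nabla_cov2 (T : 'I_n -> 'I_n -> V -> R) (a b c : 'I_n) (x : V) : R :=
  pd a (T b c) x - \sum_d G a b d x * T d c x - \sum_d G a c d x * T b d x.

(* nabla_a on n-forms; the sum is the trace of the connection matrix *)
Definition nabla_form (e : V -> R) (a : 'I_n) (x : V) : R :=
  pd a e x - (\sum_c G a c c x) * e x.

(* The connection induced on (Lambda^n)^(- w / (n + 1)) adds the term
   w / (n + 1) * G_{ac}^c to the covariant derivative. *)
Definition weight_term (w : R) (a : 'I_n) (x : V) : R :=
  w / n.+1%:R * \sum_c G a c c x.

(* nabla_a rho, nabla_a mu^b, nabla_a sigma^{bc} for fields of weight w *)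
Definition nabla_w0 (w : R) (rho : V -> R) (a : 'I_n) (x : V) : R :=
  pd a rho x + weight_term w a x * rho x.

Definition nabla_w1 (w : R) (mu : V -> V) (a b : 'I_n) (x : V) : R :=
  pd a (fun y => mu y 0 b) x + \sum_d G a d b x * mu x 0 d
  + weight_term w a x * mu x 0 b.

Definition nabla_w2 (w : R) (sigma : V -> 'M[R]_n) (a b c : 'I_n) (x : V) : R :=
  pd a (fun y => sigma y b c) x
  + \sum_d G a d b x * sigma x d c + \sum_d G a d c x * sigma x b d
  + weight_term w a x * sigma x b c.

(* (nabla_a nabla_b - nabla_b nabla_a) X^c *)
Definition commutator (X : 'I_n -> V -> R) (a b c : 'I_n) (x : V) : R :=
  nabla_mixed (nabla_vec X) a b c x - nabla_mixed (nabla_vec X) b a c x.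

(* R_{ab}^c_d, where (nabla_a nabla_b - nabla_b nabla_a) X^c = R_{ab}^c_d X^d.
   The left-hand side is tensorial in X, so the coefficient R_{ab}^c_d is its
   value on the d-th coordinate vector field. *)
Definition riemann (a b c d : 'I_n) (x : V) : R :=
  commutator (fun e _ => delta d e) a b c x.

(* R_{ad}, where (nabla_b nabla_a - nabla_a nabla_b) X^b = R_{ad} X^d *)
Definition ricci (a d : 'I_n) (x : V) : R := \sum_b riemann b a b d x.

Definition schouten (a b : 'I_n) (x : V) : R := ricci a b x / n.-1%:R.

(* W_{ab}^c_d *)
Definition weyl (a b c d : 'I_n) (x : V) : R :=
  riemann a b c d x - delta a c * schouten b d x + delta b c * schouten a d x.

(* Y_{abc} *)
Definition cotton_york (a b c : 'I_n) (x : V) : R :=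
  (nabla_cov2 schouten a b c x - nabla_cov2 schouten b a c x) / 2.

End Christoffel.
End LocalCalculus.

(* Second countable Hausdorff space with a smooth oriented atlas.  Only the
   values of chart i on dom i and of chart_inv i on the image of dom i are
   meaningful. *)
Record oriented_manifold (R : realType) (n : nat) := OrientedManifold {
  carrier :> topologicalType;
  manifold_hausdorff : hausdorff_space carrier;
  manifold_second_countable : @second_countable carrier;
  chart_index : Type;
  dom : chart_index -> set carrier;
  chart : chart_index -> carrier -> 'rV[R]_n;
  chart_inv : chart_index -> 'rV[R]_n -> carrier;
  dom_open : forall i, open (dom i);
  dom_cover : forall p, exists i, dom i p;
  chart_open : forall i, open (chart i @` dom i);
  chartK : forall i p, dom i p -> chart_inv i (chart i p) = p;
  chart_continuous : forall i, {within dom i, continuous (chart i)};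
  chart_inv_continuous :
    forall i, {within chart i @` dom i, continuous (chart_inv i)};
  transition_smooth : forall i j (b : 'I_n),
    smooth_on (chart i @` (dom i `&` dom j))
              (fun x => chart j (chart_inv i x) 0 b);
  transition_oriented : forall i j x, (chart i @` (dom i `&` dom j)) x ->
    0 < \det (\matrix_(a < n, b < n)
                pd a (fun y => chart j (chart_inv i y) 0 b) x)
}.

Section Fields.
Context {R : realType} {n : nat} (M : oriented_manifold R n).
Local Notation V := 'rV[R]_n.
Local Notation I := (chart_index M).

Definition chart_im (i : I) : set V := chart i @` dom i.
Definition overlap (i j : I) : set V := chart i @` (dom i `&` dom j).
Definition transition (i j : I) (x : V) : V := chart j (chart_inv i x).

(* entry (a, b) is d y^b / d x^a for y = transition i j x *)
Definition jac (i j : I) (x : V) : 'M[R]_n :=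
  \matrix_(a, b) pd a (fun y => transition i j y 0 b) x.

(* transition factor of the line bundle (Lambda^n)^(- w / (n + 1)) *)
Definition weight_factor (w : R) (i j : I) (x : V) : R :=
  (\det (jac i j x)) `^ (w / n.+1%:R).

(* sections of E(w) *)
Record wfun (w : R) := WFun {
  wfun_comp :> I -> V -> R;
  wfun_smooth : forall i, smooth_on (chart_im i) (wfun_comp i);
  wfun_off : forall i x, ~ chart_im i x -> wfun_comp i x = 0;
  wfun_law : forall i j x, overlap i j x ->
    wfun_comp j (transition i j x) = weight_factor w i j x * wfun_comp i x
}.

(* sections of E^b(w) *)
Record wvec (w : R) := WVec {
  wvec_comp :> I -> V -> 'rV[R]_n;
  wvec_smooth : forall i b, smooth_on (chart_im i) (fun x => wvec_comp i x 0 b);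
  wvec_off : forall i x, ~ chart_im i x -> wvec_comp i x = 0;
  wvec_law : forall i j x, overlap i j x ->
    wvec_comp j (transition i j x) =
      weight_factor w i j x *: (wvec_comp i x *m jac i j x)
}.

(* sections of E^(bc)(w), symmetric in b, c *)
Record wsym2 (w : R) := WSym2 {
  wsym2_comp :> I -> V -> 'M[R]_n;
  wsym2_smooth :
    forall i b c, smooth_on (chart_im i) (fun x => wsym2_comp i x b c);
  wsym2_off : forall i x, ~ chart_im i x -> wsym2_comp i x = 0;
  wsym2_sym : forall i x, (wsym2_comp i x)^T = wsym2_comp i x;
  wsym2_law : forall i j x, overlap i j x ->
    wsym2_comp j (transition i j x) =
      weight_factor w i j x *: ((jac i j x)^T *m wsym2_comp i x *m jac i j x)
}.

Record one_form := OneForm {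
  one_form_comp :> I -> V -> 'rV[R]_n;
  one_form_smooth :
    forall i a, smooth_on (chart_im i) (fun x => one_form_comp i x 0 a);
  one_form_off : forall i x, ~ chart_im i x -> one_form_comp i x = 0;
  one_form_law : forall i j x, overlap i j x ->
    one_form_comp i x = one_form_comp j (transition i j x) *m (jac i j x)^T
}.

Record volume_form := VolumeForm {
  volume_form_comp :> I -> V -> R;
  volume_form_smooth : forall i, smooth_on (chart_im i) (volume_form_comp i);
  volume_form_off : forall i x, ~ chart_im i x -> volume_form_comp i x = 0;
  volume_form_neq0 : forall i x, chart_im i x -> volume_form_comp i x != 0;
  volume_form_law : forall i j x, overlap i j x ->
    volume_form_comp i x =
      \det (jac i j x) * volume_form_comp j (transition i j x)
}.

(* torsion-free affine connections *)
Record connection := Connection {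
  conn_comp :> I -> @christoffel R n;
  conn_smooth : forall i a b c, smooth_on (chart_im i) (conn_comp i a b c);
  conn_off : forall i x, ~ chart_im i x ->
    forall a b c, conn_comp i a b c x = 0;
  conn_torsion_free : forall i a b c x, chart_im i x ->
    conn_comp i a b c x = conn_comp i b a c x;
  conn_law : forall i j x, overlap i j x -> forall a b k,
    \sum_c conn_comp i a b c x * jac i j x c k =
      pd a (fun y => jac i j y b k) x
      + \sum_l \sum_m
          jac i j x a l * jac i j x b m
          * conn_comp j l m k (transition i j x)
}.

Definition special (D : connection) : Prop :=
  exists e : volume_form, forall i x, chart_im i x ->
    forall a, nabla_form (D i) (e i) a x = 0.

Definition proj_change (D D' : connection) (U : one_form) : Prop :=
  forall (i : I) (X : 'I_n -> V -> R),
    (forall b, smooth_on (chart_im i) (X b)) ->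
    forall x, chart_im i x -> forall a b,
      nabla_vec (D' i) X a b x =
        nabla_vec (D i) X a b x + U i x 0 a * X b x
        + delta a b * \sum_c U i x 0 c * X c x.

Definition proj_equiv (D D' : connection) : Prop :=
  exists U : one_form, proj_change D D' U.

Record projective_structure := ProjectiveStructure {
  proj_class :> connection -> Prop;
  proj_class_nonempty : exists D, proj_class D;
  proj_classP :
    forall D D', proj_class D -> (proj_class D' <-> proj_equiv D D')
}.

Definition special_in (P : projective_structure) : Type :=
  {D : connection | P D /\ special D}.

Definition special_conn (P : projective_structure) (D : special_in P) :
  connection := proj1_sig D.
Coercion special_conn : special_in >-> connection.

Definition triple : Type := (wsym2 (-2) * wvec (-2) * wfun (-2))%type.

Definition triple_change (U : one_form) (t t' : triple) : Prop :=
  let: (sigma, mu, rho) := t in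
  let: (sigma', mu', rho') := t' in
  forall i x, chart_im i x ->
  [/\ forall b c, sigma' i x b c = sigma i x b c,
      forall b, mu' i x 0 b = mu i x 0 b + \sum_c U i x 0 c * sigma i x b c
    & rho' i x = rho i x + 2 * (\sum_b U i x 0 b * mu i x 0 b)
                 + \sum_b \sum_c U i x 0 b * U i x 0 c * sigma i x b c].

(* Sections of the tractor bundle E^(BC): a triple for every special
   connection in the class, subject to the law of change of connection. *)
Record tractor (P : projective_structure) := Tractor {
  tractor_rep :> special_in P -> triple;
  tractor_change : forall (D D' : special_in P) (U : one_form),
    proj_change D D' U -> triple_change U (tractor_rep D) (tractor_rep D')
}.

(* values (sigma^{bc}, mu^b, rho) at a point of a chart *)
Definition column : Type := ('M[R]_n * 'rV[R]_n * R^o)%type.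

(* the tractor connection in the splitting given by D, direction a *)
Definition tractor_nabla (D : connection) (t : triple) (i : I) (a : 'I_n)
    (x : V) : column :=
  let: (sigma, mu, rho) := t in
  (\matrix_(b, c) (nabla_w2 (D i) (-2) (sigma i) a b c x
                   - delta a b * mu i x 0 c - delta a c * mu i x 0 b),
   \row_b (nabla_w1 (D i) (-2) (mu i) a b x - delta a b * rho i x
           + \sum_c schouten (D i) a c x * sigma i x b c),
   nabla_w0 (D i) (-2) (rho i) a x
   + 2 * \sum_b schouten (D i) a b x * mu i x 0 b).

(* (0, W_{ac}^b_d sigma^{cd}, 4 Y_{abc} sigma^{bc}) *)
Definition curvature_term (D : connection) (t : triple) (i : I) (a : 'I_n)
    (x : V) : column :=
  let: (sigma, _, _) := t in
  (0,
   \row_b \sum_c \sum_d weyl (D i) a c b d x * sigma i x c d,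
   4 * \sum_b \sum_c cotton_york (D i) a b c x * sigma i x b c).

Definition prolonged_equation (P : projective_structure) (D : special_in P)
    (t : tractor P) : Prop :=
  forall i x, chart_im i x -> forall a,
    tractor_nabla D (t D) i a x
    - n%:R^-1 *: curvature_term D (t D) i a x = 0 :> column.

(* nabla_a sigma^{bc} = delta_a^b mu^c + delta_a^c mu^b for some mu *)
Definition metrizability_equation (D : connection) (sigma : wsym2 (-2)) : Prop :=
  exists mu : wvec (-2), forall i x, chart_im i x -> forall a b c,
    nabla_w2 (D i) (-2) (sigma i) a b c x =
      delta a b * mu i x 0 c + delta a c * mu i x 0 b.

Definition tractor_sigma (P : projective_structure) (D : special_in P)
    (t : tractor P) : wsym2 (-2) :=
  let: (sigma, _, _) := t D in sigma.

End Fields.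

(* Main.v *)
(* Antisymmetrising the derivative of the metrizability equation and tracing
   once gives n nabla_a mu^b = t delta_a^b - R_{ac} sigma^{cb}
   + R_{ac}^b_d sigma^{cd} with t = nabla_b mu^b, which is the second row of the
   prolonged system for rho = (t + P_{bc} sigma^{bc}) / n.  Antisymmetrising the
   derivative of this identity and tracing again, with the contracted second
   Bianchi identity, gives the third row.  The volume form enters through
   flatness of the density bundles (hence R_{ab}^c_c = 0 and symmetry of R_{ab})
   and through the logarithmic derivative of the Jacobian determinant, which
   makes rho a weighted function.  Conversely mu and rho are determined by sigma
   through the first two rows, and the value of a tractor at one special
   connection determines it at all of them, because the 1-form relating two
   projectively equivalent connections is the trace of their difference. *)

From HB Require Import structures.
Require Import Defs.
From mathcomp Require Import all_boot all_order all_algebra.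
From mathcomp Require Import all_classical all_reals all_analysis.
From mathcomp Require Import ring lra.

Set Implicit Arguments.
Unset Strict Implicit.
Unset Printing Implicit Defensive.

Import Order.TTheory GRing.Theory Num.Theory numFieldNormedType.Exports.

Local Open Scope classical_set_scope.
Local Open Scope ring_scope.

(** * Partial derivatives and smooth functions *)

(** Index calculus is replaced by matrix calculus: a field with one vector index is a row, the
    connection in a fixed direction is a matrix acting from the right, and the remaining lower
    indices are mere labels. Connection terms on labels cancel by torsion-freeness wherever two
    labels are antisymmetrised, so the commutators become noncommutative polynomial identities
    between matrices. Smoothness is iterated Frechet differentiability, and the symmetry of second
    partials is derived from second differences. The field mu is global from the start, whereas rho
    is given by a coordinate formula; gluing it takes the transformation laws of the Ricci tensor
    and of the divergence of a weighted vector. The determinant occurring there is differentiated as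
    a quotient of two parallel volume forms. *)

Lemma near_eq_differentiable {R : numFieldType} {V W : normedModType R}
    (f g : V -> W) (x : V) :
  (\near x, f x = g x) -> differentiable f x -> differentiable g x.
Proof.
(* The difference vanishes near x, so the zero map is its differential; adding it back to f gives
   g. *)
move=> fg df; pose h y := g y - f y.
have h0 : \near x, h x = 0.
  by apply: filterS fg => y fgy; rewrite /h fgy subrr.
have hx : h x = 0 by exact: nbhs_singleton h0.
have E : h \o shift x = cst (h x) + 'd (cst (0 : W)) x +o_ (0 : V) id.
  apply/eqaddoP => _/posnumP[e]; near=> y.
  rewrite diff_cst hx addr0 /=.
  rewrite [X in `|X|](_ : _ = h (y + x)); last first.
    by rewrite -[LHS]/(h (y + x) - 0) subr0.
  rewrite [h (y + x)](_ : _ = 0) ?normr0 ?mulr_ge0 //.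
  by rewrite addrC; near: y; exact: (nbhs0P _ x).1 h0.
have dh : differentiable h x.
  have dc : continuous ('d (cst (0 : W)) x).
    by rewrite diff_cst => ?; exact: cvg_cst.
  by apply/diff_locallyP; rewrite (diff_unique dc E).
rewrite (_ : g = f + h); first exact: differentiableD.
by apply/funext => y; rewrite -[RHS]/(f y + (g y - f y)) addrC subrK.
Unshelve. all: by end_near. Qed.

Section PartialDerivatives.
Context {R : realType} {n : nat}.
Local Notation V := 'rV[R]_n.
Implicit Types (U : set V) (f g : V -> R) (x : V) (a b : 'I_n).

Lemma pd_diff f x a : differentiable f x -> pd a f x = 'd f x (delta_mx 0 a).
Proof. by move=> df; rewrite /pd deriveE. Qed.

Lemma pd_eq_on U f g x a : open U -> (forall y, U y -> f y = g y) -> U x ->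
  pd a f x = pd a g x.
Proof.
move=> oU fg Ux; apply: near_eq_derive.
by near do apply: fg; exact: open_nbhs_nbhs.
Unshelve. all: by end_near. Qed.

Lemma differentiable_eq_on U f g x : open U -> (forall y, U y -> f y = g y) ->
  U x -> differentiable f x -> differentiable g x.
Proof.
move=> oU fg Ux; apply: near_eq_differentiable.
by near do apply: fg; exact: open_nbhs_nbhs.
Unshelve. all: by end_near. Qed.

Lemma pd_cst (c : R) a x : pd a (fun=> c) x = 0.
Proof. exact: derive_cst. Qed.

Lemma pdD f g a x : differentiable f x -> differentiable g x ->
  pd a (fun y => f y + g y) x = pd a f x + pd a g x.
Proof. by move=> df dg; apply: deriveD; exact: diff_derivable. Qed.

Lemma pdN f a x : differentiable f x -> pd a (fun y => - f y) x = - pd a f x.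
Proof. by move=> df; apply: deriveN; exact: diff_derivable. Qed.

Lemma pdM f g a x : differentiable f x -> differentiable g x ->
  pd a (fun y => f y * g y) x = pd a f x * g x + f x * pd a g x.
Proof.
move=> df dg; rewrite /pd deriveM; try exact: diff_derivable.
by rewrite addrC; congr (_ + _); rewrite mulrC.
Qed.

Lemma pdV f a x : differentiable f x -> f x != 0 ->
  pd a (fun y => (f y)^-1) x = - (f x) ^- 2 * pd a f x.
Proof. by move=> df f0; rewrite /pd deriveV //; exact: diff_derivable. Qed.

Lemma differentiable_bigsum m (f : 'I_m -> V -> R) x :
  (forall i, differentiable (f i) x) ->
  differentiable (fun y => \sum_i f i y) x.
Proof.
move=> df; rewrite (_ : (fun y => _) = \sum_i f i); last first.
  by apply/funext => y; rewrite fct_sumE.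
exact: differentiable_sum.
Qed.

Lemma pd_sum m (f : 'I_m -> V -> R) a x : (forall i, differentiable (f i) x) ->
  pd a (fun y => \sum_i f i y) x = \sum_i pd a (f i) x.
Proof.
move=> df; rewrite (_ : (fun y => _) = \sum_i f i); last first.
  by apply/funext => y; rewrite fct_sumE.
by rewrite /pd derive_sum // => i; exact: diff_derivable.
Qed.

Lemma differentiable_row (phi : V -> V) x :
  (forall b, differentiable (fun y => phi y 0 b) x) -> differentiable phi x.
Proof.
move=> dphi.
rewrite (_ : phi = \sum_b (fun y => phi y 0 b *: delta_mx 0 b)); last first.
  by apply/funext => y; rewrite fct_sumE -row_sum_delta.
by apply: differentiable_sum => b; exact: differentiableZl.
Qed.

Lemma pd_comp (phi : V -> V) g a x :
  (forall b, differentiable (fun y => phi y 0 b) x) ->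
  differentiable g (phi x) ->
  pd a (fun y => g (phi y)) x
    = \sum_b pd a (fun y => phi y 0 b) x * pd b g (phi x).
Proof.
move=> dphi dg; have dp := differentiable_row dphi.
rewrite pd_diff; last exact: differentiable_comp.
rewrite (_ : 'd _ x (delta_mx 0 a) = 'd g (phi x) ('d phi x (delta_mx 0 a)));
  last by have /(congr1 (fun h => h (delta_mx 0 a))) := diff_comp dp dg.
rewrite {1}(row_sum_delta ('d phi x (delta_mx 0 a))) linear_sum /=.
apply: eq_bigr => b _; rewrite linearZ /= (pd_diff b dg); congr (_ * _).
have dc := differentiable_coord (phi x) 0 b.
rewrite pd_diff //.
have /(congr1 (fun h => h (delta_mx 0 a))) /= := diff_comp dp dc.
rewrite /comp => ->.
(* The b-th coordinate, packaged as a linear map so that [diff_lin] identifies it with its own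
   differential. *)
pose c (N : V) : R := N 0 b.
have c_lin : linear c by move=> k u v; rewrite /c !mxE.
pose cM := GRing.isLinear.Build _ _ _ _ _ c_lin.
pose cL : {linear V -> R} := HB.pack c cM.
by rewrite (@diff_lin _ _ _ cL) //; exact: coord_continuous.
Qed.

(** * Symmetry of second partial derivatives *)

Lemma is_derive_line f (c v : V) (t : R) : differentiable f (c + t *: v) ->
  is_derive t 1 (fun s => f (c + s *: v)) ('D_v f (c + t *: v)).
Proof.
move=> df.
have E : (fun h : R => h^-1 *: (f (h *: v + (c + t *: v)) - f (c + t *: v)))
    = (fun h : R => h^-1 *: (f (c + (h *: 1 + t) *: v) - f (c + t *: v))).
  apply/funext => h; congr (_ *: (f _ - _)).
  by rewrite scalerDl addrCA; congr (_ + (_ + _)); rewrite [h *: 1]mulr1.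
have dv : derivable f (c + t *: v) v by exact: diff_derivable.
by apply: DeriveDef; rewrite /derivable /derive /= -E.
Qed.

Lemma differentiable_bound {W : normedModType R} (f : V -> W) x (e : R) :
  0 < e -> differentiable f x ->
  \forall v \near (0 : V), `|f (x + v) - f x - 'd f x v| <= e * `|v|.
Proof.
move=> e0 /diff_locallyP[_ /eqaddoP/(_ _ e0)].
by apply: filterS => v; rewrite [x + v]addrC -addrA -opprD.
Qed.

(** Divided by h^2 it tends to a mixed second derivative; its symmetry in a and b forces the two
    orders to agree. *)
Definition second_difference f x a b (h : R) : R :=
  f (x + (h *: delta_mx 0 a + h *: delta_mx 0 b))
  - f (x + h *: delta_mx 0 b) - f (x + h *: delta_mx 0 a) + f x.

(** The mean value theorem in direction a writes the second difference as h times an increment of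
    [pd a f] between two points near x; differentiability of [pd a f] at x alone then controls the
    error. *)
Lemma second_difference_approx U f x a b (e : R) : open U -> U x ->
  (forall y, U y -> differentiable f y) -> differentiable (pd a f) x ->
  0 < e -> exists2 d : R, 0 < d & forall h, 0 < h < d ->
    `|second_difference f x a b h - h ^+ 2 * pd b (pd a f) x| <= e * h ^+ 2.
Proof.
move=> oU Ux df dg e0; set g := pd a f.
(* The two error terms below belong to displacements of norm at most 2h and h, hence the share e /
   3. *)
have e30 : 0 < e / 3 by rewrite divr_gt0.
have nU : \forall v \near (0 : V), U (x + v).
  by apply: (nbhs0P _ x).1; exact: open_nbhs_nbhs.
have /nbhs_norm0P[d /= d0 Hd] :
    \forall v \near (0 : V), `|g (x + v) - g x - 'd g x v| <= e / 3 * `|v|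
      /\ U (x + v).
  by apply: filterI nU; exact: differentiable_bound.
exists (d / 2) => [|h /andP[h0 hd]]; first by rewrite divr_gt0.
pose ea : V := delta_mx 0 a; pose eb : V := delta_mx 0 b.
have norm_e c : `|delta_mx 0 c : V| <= 1.
  have [->|/mx_norm_neq0[ij E]] := eqVneq `|delta_mx 0 c : V| 0; first exact: ler01.
  rewrite [leLHS](E : `|delta_mx 0 c : V| = _).
  by rewrite mxE; case: (_ && _); rewrite ?normr1 ?normr0 ?ler01.
(* Its increment over [0, h] is the second difference. *)
pose G t := f ((x + h *: eb) + t *: ea) - f (x + t *: ea).
have small c s : 0 <= s <= h -> 0 <= c <= h ->
    let v := s *: ea + c *: eb in `|v| <= s + c /\ `|v| < d.
  move=> /andP[s0 sh] /andP[c0 ch] v.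
  have le_v : `|v| <= s + c.
    rewrite (le_trans (ler_normD _ _)) // !normrZ !ger0_norm //.
    by apply: lerD; rewrite ler_piMr // norm_e.
  by split => //; apply: le_lt_trans le_v _; lra.
have small1 s : 0 <= s <= h -> `|s *: ea| <= s /\ `|s *: ea| < d.
  move=> hs; have h00 : 0 <= (0 : R) <= h by rewrite lexx ltW.
  by have := small 0 s hs h00; rewrite scale0r !addr0.
have hh : 0 <= h <= h by rewrite lexx ltW.
have dG t : t \in `[0, h] ->
    is_derive t 1 G (g ((x + h *: eb) + t *: ea) - g (x + t *: ea)).
  rewrite in_itv /= => ht.
  have U1 : U ((x + h *: eb) + t *: ea).
    rewrite -addrA [h *: eb + _]addrC.
    by apply: (Hd _ _).2; have [] := small h t ht hh.
  have U2 : U (x + t *: ea).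
    by apply: (Hd _ _).2; have [] := small1 t ht.
  by apply: is_deriveB; apply: is_derive_line; exact: df.
have cG : {within `[0, h], continuous G}.
  by apply: derivable_within_continuous => t /dG [].
pose dGt t := g ((x + h *: eb) + t *: ea) - g (x + t *: ea).
have dGo t : t \in `]0, h[ -> is_derive t 1 G (dGt t).
  by move=> /subset_itv_oo_cc; exact: dG.
have [c chh] := @MVT_segment R G dGt 0 h (ltW h0) dGo cG.
rewrite /dGt {dGt dGo}.
rewrite subr0; move: chh; rewrite in_itv /= => hc.
have -> : G h - G 0 = second_difference f x a b h.
  rewrite /G /second_difference !scale0r !addr0 -/ea -/eb.
  rewrite -[x + h *: eb + _]addrA [h *: eb + _]addrC.
  by ring.
move=> ->.
have [n1 lt1] := small h c hc hh; have [n2 lt2] := small1 c hc.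
have [B1 _] := Hd (c *: ea + h *: eb) lt1.
have [B2 _] := Hd (c *: ea) lt2.
have -> : x + h *: eb + c *: ea = x + (c *: ea + h *: eb).
  by rewrite -addrA [h *: eb + _]addrC.
rewrite (pd_diff b dg) -/eb.
move: B1; rewrite linearD /= ['d g x (h *: eb)]linearZ /= => B1.
rewrite (_ : _ - _ = h * ((g (x + (c *: ea + h *: eb)) - g x
    - ('d g x (c *: ea) + h * 'd g x eb))
    - (g (x + c *: ea) - g x - 'd g x (c *: ea)))); last by ring.
rewrite normrM gtr0_norm // [leRHS](_ : _ = h * (e * h)); last by ring.
rewrite ler_wpM2l // ?(ltW h0) //.
rewrite (le_trans (ler_normB _ _)) // (le_trans (lerD B1 B2)) //.
have le1 : e / 3 * `|c *: ea + h *: eb| <= e / 3 * (h + h).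
  by rewrite ler_wpM2l ?(ltW e30) // (le_trans n1) //; lra.
have le2 : e / 3 * `|c *: ea| <= e / 3 * h.
  by rewrite ler_wpM2l ?(ltW e30) // (le_trans n2) //; lra.
by rewrite (le_trans (lerD le1 le2)) // -mulrDr; lra.
Qed.

(** Young's theorem: for small h both mixed derivatives, times h^2, lie within e / 2 * h^2 of the
    same second difference. *)
Lemma pd_comm_at U f x a b : open U -> U x ->
  (forall y, U y -> differentiable f y) ->
  differentiable (pd a f) x -> differentiable (pd b f) x ->
  pd a (pd b f) x = pd b (pd a f) x.
Proof.
move=> oU Ux df da db; apply/eqP; rewrite -subr_eq0 -normr_le0.
apply/ler_addgt0Pr => e e0; rewrite add0r.
have e20 : 0 < e / 2 by rewrite divr_gt0.
have [d1 d10 H1] := second_difference_approx b oU Ux df da e20.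
have [d2 d20 H2] := second_difference_approx a oU Ux df db e20.
pose h := Num.min d1 d2 / 2.
have m0 : 0 < Num.min d1 d2 by rewrite lt_min d10.
have h0 : 0 < h by rewrite divr_gt0.
have hm : h < Num.min d1 d2 by rewrite /h; lra.
move: hm; rewrite lt_min => /andP[hd1 hd2].
have {H1} := H1 h; rewrite h0 hd1 => /(_ isT) H1.
have {H2} := H2 h; rewrite h0 hd2 => /(_ isT) H2.
have E : second_difference f x b a h = second_difference f x a b h.
  rewrite /second_difference [h *: delta_mx 0 b + _]addrC; ring.
rewrite E in H2.
rewrite -(@ler_pM2l _ (h ^+ 2)) ?exprn_gt0 //.
set p := pd a _ x in H2 *; set q := pd b _ x in H1 *.
set s := second_difference f x a b h in H1 H2.
have -> : h ^+ 2 * `|p - q| = `|(s - h ^+ 2 * q) - (s - h ^+ 2 * p)|.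
  rewrite (_ : _ - (s - _) = h ^+ 2 * (p - q)); last by ring.
  by rewrite normrM ger0_norm // sqr_ge0.
rewrite (le_trans (ler_normB _ _)) // (le_trans (lerD H1 H2)) // -mulrDl.
by rewrite -splitr mulrC.
Qed.

(** * Closure properties of smoothness *)

Lemma diff_upto_eq k U f g : open U -> (forall y, U y -> f y = g y) ->
  diff_upto k U f -> diff_upto k U g.
Proof.
elim: k f g => //= k IH f g oU fg [df dpf]; split=> [x Ux|a].
  by apply: (differentiable_eq_on oU fg Ux); exact: df.
apply: (IH (pd a f)) => // x Ux; exact: pd_eq_on Ux.
Qed.

Lemma diff_uptoW k U f : diff_upto k.+1 U f -> diff_upto k U f.
Proof.
elim: k f => //= k IH f [df dpf]; split => // a.
by apply: IH; exact: dpf.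
Qed.

Lemma diff_upto_subset k U U' f : U `<=` U' ->
  diff_upto k U' f -> diff_upto k U f.
Proof.
move=> sub; elim: k f => //= k IH f [df dpf]; split => [x /sub|a]; first exact: df.
by apply: IH; exact: dpf.
Qed.

Lemma diff_upto_cst k U (c : R) : diff_upto k U (fun=> c).
Proof.
elim: k c => //= k IH c; split=> [x _|a]; first exact: differentiable_cst.
by rewrite (_ : pd a _ = fun=> 0) //; apply/funext => x; rewrite pd_cst.
Qed.

Lemma diff_uptoD k U f g : open U -> diff_upto k U f -> diff_upto k U g ->
  diff_upto k U (fun y => f y + g y).
Proof.
move=> oU; elim: k f g => //= k IH f g [df dpf] [dg dpg]; split=> [x Ux|a].
  by apply: differentiableD; [exact: df | exact: dg].
apply: (diff_upto_eq oU _ (IH _ _ (dpf a) (dpg a))) => x Ux.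
by rewrite pdD //; [exact: df | exact: dg].
Qed.

Lemma diff_uptoM k U f g : open U -> diff_upto k U f -> diff_upto k U g ->
  diff_upto k U (fun y => f y * g y).
Proof.
move=> oU; elim: k f g => // k IH f g fk gk.
have [df dpf] := fk; have [dg dpg] := gk; split=> [x Ux|a].
  by apply: differentiableM; [exact: df | exact: dg].
apply: (diff_upto_eq oU _ (diff_uptoD oU (IH _ _ (dpf a) (diff_uptoW gk))
   (IH _ _ (diff_uptoW fk) (dpg a)))) => x Ux.
by rewrite pdM //; [exact: df | exact: dg].
Qed.

Lemma smooth_on_diff U f x : smooth_on U f -> U x -> differentiable f x.
Proof. by move=> sf; have [df _] := sf 1%N; exact: df. Qed.

Lemma smooth_on_pd U f a : smooth_on U f -> smooth_on U (pd a f).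
Proof. by move=> sf k; have [_ H] := sf k.+1; exact: H. Qed.

Lemma smooth_on_eq U f g : open U -> (forall y, U y -> f y = g y) ->
  smooth_on U f -> smooth_on U g.
Proof. by move=> oU fg sf k; exact: diff_upto_eq (sf k). Qed.

Lemma smooth_on_subset U U' f : U `<=` U' -> smooth_on U' f -> smooth_on U f.
Proof. by move=> sub sf k; exact: diff_upto_subset (sf k). Qed.

Lemma smooth_on_cst U (c : R) : smooth_on U (fun=> c).
Proof. by move=> k; exact: diff_upto_cst. Qed.

Lemma smooth_onD U f g : open U -> smooth_on U f -> smooth_on U g ->
  smooth_on U (fun y => f y + g y).
Proof. by move=> oU sf sg k; exact: diff_uptoD. Qed.

Lemma smooth_onM U f g : open U -> smooth_on U f -> smooth_on U g ->
  smooth_on U (fun y => f y * g y).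
Proof. by move=> oU sf sg k; exact: diff_uptoM. Qed.

Lemma smooth_onN U f : open U -> smooth_on U f -> smooth_on U (fun y => - f y).
Proof.
move=> oU sf; apply: (smooth_on_eq oU _ (smooth_onM oU (smooth_on_cst U (-1)) sf)).
by move=> y _; rewrite mulN1r.
Qed.

Lemma smooth_on_sum U m (f : 'I_m -> V -> R) : open U ->
  (forall i, smooth_on U (f i)) -> smooth_on U (fun y => \sum_i f i y).
Proof.
move=> oU; elim: m f => [|m IH] f sf.
  by apply: (smooth_on_eq oU _ (smooth_on_cst U 0)) => y _; rewrite big_ord0.
apply: (smooth_on_eq oU _ (smooth_onD oU (IH _ (fun i => sf (widen_ord (leqnSn m) i)))
   (sf ord_max))) => y _.
by rewrite big_ord_recr.
Qed.

Lemma pd_comm U f x a b : open U -> smooth_on U f -> U x ->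
  pd a (pd b f) x = pd b (pd a f) x.
Proof.
move=> oU sf Ux; apply: (pd_comm_at oU Ux) => [y||]; first exact: smooth_on_diff.
  by apply: smooth_on_diff Ux; exact: smooth_on_pd.
by apply: smooth_on_diff Ux; exact: smooth_on_pd.
Qed.

End PartialDerivatives.

(* Otherwise unification unfolds derivatives down to limits. *)
Opaque pd.

(** * Matrix-valued functions *)

Section MatrixCalculus.
Context {R : realType} {n : nat}.
Local Notation V := 'rV[R]_n.
Implicit Types (U : set V) (x : V) (a b : 'I_n).

Definition mx_differentiable p q (F : V -> 'M[R]_(p, q)) x :=
  forall i j, differentiable (fun y => F y i j) x.

Definition mx_smooth_on U p q (F : V -> 'M[R]_(p, q)) :=
  forall i j, smooth_on U (fun y => F y i j).

Definition mpd p q a (F : V -> 'M[R]_(p, q)) x : 'M[R]_(p, q) :=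
  \matrix_(i, j) pd a (fun y => F y i j) x.

Lemma mpdE p q a (F : V -> 'M[R]_(p, q)) x i j :
  mpd a F x i j = pd a (fun y => F y i j) x.
Proof. by rewrite mxE. Qed.

Lemma mx_smooth_on_diff U p q (F : V -> 'M[R]_(p, q)) x :
  mx_smooth_on U F -> U x -> mx_differentiable F x.
Proof. by move=> sF Ux i j; apply: smooth_on_diff Ux. Qed.

Lemma mpd_eq_on U p q (F H : V -> 'M[R]_(p, q)) a x : open U ->
  (forall y, U y -> F y = H y) -> U x -> mpd a F x = mpd a H x.
Proof.
move=> oU FH Ux; apply/matrixP => i j; rewrite !mxE.
by apply: pd_eq_on Ux => // y Uy; rewrite FH.
Qed.

Lemma mpdD p q (F H : V -> 'M[R]_(p, q)) a x :
  mx_differentiable F x -> mx_differentiable H x ->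
  mpd a (fun y => F y + H y) x = mpd a F x + mpd a H x.
Proof.
move=> dF dH; apply/matrixP => i j; rewrite !mxE -pdD //.
by congr (pd _ _ _); apply/funext => y; rewrite mxE.
Qed.

Lemma mpdN p q (F : V -> 'M[R]_(p, q)) a x :
  mx_differentiable F x -> mpd a (fun y => - F y) x = - mpd a F x.
Proof.
move=> dF; apply/matrixP => i j; rewrite !mxE -pdN //.
by congr (pd _ _ _); apply/funext => y; rewrite mxE.
Qed.

Lemma mpdM p q r (F : V -> 'M[R]_(p, q)) (H : V -> 'M[R]_(q, r)) a x :
  mx_differentiable F x -> mx_differentiable H x ->
  mpd a (fun y => F y *m H y) x = mpd a F x *m H x + F x *m mpd a H x.
Proof.
move=> dF dH; apply/matrixP => i j; rewrite !mxE -big_split /=.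
rewrite (_ : (fun y => _) = fun y => \sum_k F y i k * H y k j); last first.
  by apply/funext => y; rewrite mxE.
rewrite pd_sum => [|k]; last by apply: differentiableM; [exact: dF|exact: dH].
by apply: eq_bigr => k _; rewrite !mxE pdM.
Qed.

Lemma mpdZ p q (k : V -> R) (F : V -> 'M[R]_(p, q)) a x :
  differentiable k x -> mx_differentiable F x ->
  mpd a (fun y => k y *: F y) x = pd a k x *: F x + k x *: mpd a F x.
Proof.
move=> dk dF; apply/matrixP => i j; rewrite !mxE -pdM //.
by congr (pd _ _ _); apply/funext => y; rewrite mxE.
Qed.

Lemma mpd_sum p q m (F : 'I_m -> V -> 'M[R]_(p, q)) a x :
  (forall k, mx_differentiable (F k) x) ->
  mpd a (fun y => \sum_k F k y) x = \sum_k mpd a (F k) x.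
Proof.
move=> dF; apply/matrixP => i j; rewrite mxE summxE.
rewrite (_ : (fun y => _) = fun y => \sum_k F k y i j); last first.
  by apply/funext => y; rewrite summxE.
by rewrite pd_sum => [|k]; [apply: eq_bigr => k _; rewrite mxE | exact: dF].
Qed.

Lemma mpd_comp p q (phi : V -> V) (F : V -> 'M[R]_(p, q)) a x :
  (forall b, differentiable (fun y => phi y 0 b) x) ->
  mx_differentiable F (phi x) ->
  mpd a (fun y => F (phi y)) x
    = \sum_b pd a (fun y => phi y 0 b) x *: mpd b F (phi x).
Proof.
move=> dphi dF; apply/matrixP => i j; rewrite mxE summxE.
rewrite (@pd_comp _ _ phi (fun y => F y i j) a x dphi (dF i j)).
by apply: eq_bigr => b _; rewrite !mxE.
Qed.

Lemma mpd_comm U p q (F : V -> 'M[R]_(p, q)) a b x : open U ->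
  mx_smooth_on U F -> U x -> mpd a (mpd b F) x = mpd b (mpd a F) x.
Proof.
move=> oU sF Ux.
have E i j c d : mpd c (mpd d F) x i j = pd c (pd d (fun y => F y i j)) x.
  have E' : (fun y => mpd d F y i j) = pd d (fun y => F y i j).
    by apply/funext => y; exact: mpdE.
  by rewrite -E'; exact: mpdE.
apply/matrixP => i j; apply: etrans (E i j a b) (etrans _ (esym (E i j b a))).
exact: pd_comm a b oU (sF i j) Ux.
Qed.

Lemma mx_smooth_on_pd U p q (F : V -> 'M[R]_(p, q)) a :
  mx_smooth_on U F -> mx_smooth_on U (mpd a F).
Proof.
move=> sF i j; rewrite (_ : (fun y => _) = pd a (fun y => F y i j)).
  exact: smooth_on_pd.
by apply/funext => y; rewrite mxE.
Qed.

Lemma mx_smooth_onD U p q (F H : V -> 'M[R]_(p, q)) : open U ->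
  mx_smooth_on U F -> mx_smooth_on U H -> mx_smooth_on U (fun y => F y + H y).
Proof.
move=> oU sF sH i j; rewrite (_ : (fun y => _) = fun y => F y i j + H y i j).
  exact: smooth_onD.
by apply/funext => y; rewrite mxE.
Qed.

Lemma mx_smooth_onN U p q (F : V -> 'M[R]_(p, q)) : open U ->
  mx_smooth_on U F -> mx_smooth_on U (fun y => - F y).
Proof.
move=> oU sF i j; rewrite (_ : (fun y => _) = fun y => - F y i j).
  exact: smooth_onN.
by apply/funext => y; rewrite mxE.
Qed.

Lemma mx_smooth_onZ U p q (k : V -> R) (F : V -> 'M[R]_(p, q)) : open U ->
  smooth_on U k -> mx_smooth_on U F -> mx_smooth_on U (fun y => k y *: F y).
Proof.
move=> oU sk sF i j; rewrite (_ : (fun y => _) = fun y => k y * F y i j).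
  exact: smooth_onM.
by apply/funext => y; rewrite mxE.
Qed.

Lemma mx_smooth_on_sum U p q m (F : 'I_m -> V -> 'M[R]_(p, q)) : open U ->
  (forall k, mx_smooth_on U (F k)) -> mx_smooth_on U (fun y => \sum_k F k y).
Proof.
move=> oU sF i j; rewrite (_ : (fun y => _) = fun y => \sum_k F k y i j).
  by apply: smooth_on_sum => // k; exact: sF.
by apply/funext => y; rewrite summxE.
Qed.

Lemma mx_smooth_onM U p q r (F : V -> 'M[R]_(p, q)) (H : V -> 'M[R]_(q, r)) :
  open U -> mx_smooth_on U F -> mx_smooth_on U H ->
  mx_smooth_on U (fun y => F y *m H y).
Proof.
move=> oU sF sH i j.
rewrite (_ : (fun y => _) = fun y => \sum_k F y i k * H y k j).
  by apply: smooth_on_sum => // k; apply: smooth_onM.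
by apply/funext => y; rewrite mxE.
Qed.

Lemma mx_differentiable_tr p q (F : V -> 'M[R]_(p, q)) x :
  mx_differentiable F x -> mx_differentiable (fun y => (F y)^T) x.
Proof.
move=> dF i j; rewrite (_ : (fun y => _) = fun y => F y j i) //.
by apply/funext => y; rewrite mxE.
Qed.

Lemma mpd_tr p q (F : V -> 'M[R]_(p, q)) a x :
  mpd a (fun y => (F y)^T) x = (mpd a F x)^T.
Proof.
apply/matrixP => i j; rewrite !mxE.
by congr (pd _ _ _); apply/funext => y; rewrite mxE.
Qed.

Lemma mpd_cst p q (c : 'M[R]_(p, q)) a x : mpd a (fun=> c) x = 0.
Proof. by apply/matrixP => i j; rewrite !mxE pd_cst. Qed.

Lemma mx_smooth_on_cst U p q (c : 'M[R]_(p, q)) : mx_smooth_on U (fun=> c).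
Proof. by move=> i j; exact: smooth_on_cst. Qed.

End MatrixCalculus.

Opaque mpd.

Lemma mxD_entry (R : pzRingType) p q (A B : 'M[R]_(p, q)) i j :
  (A + B) i j = A i j + B i j.
Proof. by rewrite mxE. Qed.

Lemma mxN_entry (R : pzRingType) p q (A : 'M[R]_(p, q)) i j : (- A) i j = - A i j.
Proof. by rewrite mxE. Qed.

Lemma mx0_entry (R : pzRingType) p q i j : (0 : 'M[R]_(p, q)) i j = 0.
Proof. by rewrite mxE. Qed.

Lemma mxZ_entry (R : pzRingType) p q (k : R) (A : 'M[R]_(p, q)) i j :
  (k *: A) i j = k * A i j.
Proof. by rewrite mxE. Qed.

Lemma trmxD (R : pzRingType) p q (A B : 'M[R]_(p, q)) : (A + B)^T = A^T + B^T.
Proof. exact: linearD. Qed.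

Lemma trmxN (R : pzRingType) p q (A : 'M[R]_(p, q)) : (- A)^T = - A^T.
Proof. exact: linearN. Qed.

Lemma trmxZ (R : pzRingType) p q (k : R) (A : 'M[R]_(p, q)) : (k *: A)^T = k *: A^T.
Proof. exact: linearZ. Qed.

(* Expands a matrix identity into noncommutative monomials, whose entries
   [ring] then treats as atoms. *)
Ltac mx_ring :=
  rewrite ?(mulmxDl, mulmxDr, mulmxBl, mulmxBr, mulmxN, mulNmx, mulmxA,
            scalerDr, scalerBr, scalerDl, scalerBl, scalerN, scaleNr,
            =^~ scalemxAl, =^~ scalemxAr, scalerA, mulmx0, mul0mx);
  apply/matrixP => ? ?;
  rewrite ?(mxD_entry, mxN_entry, mxZ_entry, mx0_entry); ring.

(** * Curvature *)

Section Curvature.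
Context {R : realType} {n : nat}.
Local Notation V := 'rV[R]_n.
Implicit Types (G : @christoffel R n) (U : set V) (x : V).

(** Row convention: vector components form a row v, and the covariant derivative in direction a adds
    [v x *m conn_mx G a x]. *)
Definition conn_mx G a x : 'M[R]_n := \matrix_(d, c) G a d c x.

(** Acting from the right reverses products, hence the signs of the quadratic terms; entry (d, c) is
    R_ab^c_d. *)
Definition curv G a b x : 'M[R]_n :=
  mpd a (conn_mx G b) x - mpd b (conn_mx G a) x
  + conn_mx G b x *m conn_mx G a x - conn_mx G a x *m conn_mx G b x.

Lemma curvE G a b x : curv G a b x =
  mpd a (conn_mx G b) x - mpd b (conn_mx G a) x
  + conn_mx G b x *m conn_mx G a x - conn_mx G a x *m conn_mx G b x.
Proof. by []. Qed.

Lemma mx_smooth_conn U G a :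
  (forall a b c, smooth_on U (G a b c)) -> mx_smooth_on U (conn_mx G a).
Proof.
move=> sG i j; rewrite (_ : (fun y => _) = G a i j) //.
by apply/funext => y; rewrite mxE.
Qed.

Lemma mpd_conn G a b x i j : mpd a (conn_mx G b) x i j = pd a (G b i j) x.
Proof. by rewrite mxE; congr (pd _ _ _); apply/funext => y; rewrite mxE. Qed.

Lemma curvC G a b x : curv G a b x = - curv G b a x.
Proof. by rewrite /curv; mx_ring. Qed.

(** The first derivative of a coordinate field is a Christoffel symbol; in the second, the
    connection terms on the differentiation index are symmetric in a and b and cancel. *)
Lemma riemannE G a b c d x : (forall a b c, G a b c x = G b a c x) ->
  riemann G a b c d x = curv G a b x d c.
Proof.
move=> symG; rewrite /riemann /commutator.
have -> : nabla_vec G (fun e _ => delta d e) = fun b c => G b d c.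
  apply/funext => b'; apply/funext => c'; apply/funext => y.
  rewrite /nabla_vec pd_cst add0r (bigD1 d) //= /delta eqxx mulr1 big1 ?addr0 //.
  by move=> i /negbTE; rewrite eq_sym => ->; rewrite mulr0.
rewrite /nabla_mixed /curv !mxD_entry !mxN_entry !mpd_conn ![(_ *m _) d c]mxE.
under [X in _ = _ + X - _]eq_bigr do rewrite !mxE mulrC.
under [X in _ = _ - X]eq_bigr do rewrite !mxE mulrC.
under [X in _ - (_ - X + _) = _]eq_bigr do rewrite symG.
by ring.
Qed.

Lemma smooth_curv U G a b : open U -> (forall a b c, smooth_on U (G a b c)) ->
  mx_smooth_on U (curv G a b).
Proof.
move=> oU sG; have sA c := mx_smooth_conn c sG.
by do ![apply: mx_smooth_onD || apply: mx_smooth_onN || apply: mx_smooth_onM ||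
        apply: mx_smooth_on_pd || done || exact: sA].
Qed.

Lemma ricciE G a d x : (forall a b c, G a b c x = G b a c x) ->
  ricci G a d x = \sum_b curv G b a x d b.
Proof. by move=> symG; apply: eq_bigr => b _; rewrite riemannE. Qed.

End Curvature.

Opaque curv.

(** * Changes of coordinates *)

Section CoordinateChange.
Context {R : realType} {n : nat}.
Local Notation V := 'rV[R]_n.

Definition jacobian (phi : V -> V) x : 'M[R]_n :=
  \matrix_(a, b) pd a (fun y => phi y 0 b) x.

Definition ricci_mx (G : @christoffel R n) x : 'M[R]_n :=
  \matrix_(a, d) ricci G a d x.

Definition nabla_mx (G : @christoffel R n) (w : R) (mu : V -> V) x : 'M[R]_n :=
  \matrix_(a, b) nabla_w1 G w mu a b x.

Variables (U U' : set V) (phi : V -> V) (G G' : @christoffel R n).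
Hypothesis U_open : open U.
Hypothesis phi_maps : forall x, U x -> U' (phi x).
Hypothesis phi_smooth : forall b, smooth_on U (fun x => phi x 0 b).
Hypothesis G_smooth : forall a b c, smooth_on U (G a b c).
Hypothesis G'_smooth : forall a b c, smooth_on U' (G' a b c).

Let J := jacobian phi.

Hypothesis law : forall x, U x -> forall a b k,
  \sum_c G a b c x * J x c k = pd a (fun y => J y b k) x
    + \sum_l \sum_m J x a l * J x b m * G' l m k (phi x).

(** The connection matrices of the target chart, pulled back as a matrix-valued 1-form. *)
Let pullback a x : 'M[R]_n := \sum_l J x a l *: conn_mx G' l (phi x).

Let J_entry b m : (fun y => J y b m) = pd b (fun y => phi y 0 m).
Proof. by apply/funext => y; rewrite mxE. Qed.

Let J_smooth : mx_smooth_on U J.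
Proof. by move=> i j; rewrite J_entry; exact: smooth_on_pd. Qed.

Let J_diff x : U x -> mx_differentiable J x.
Proof. exact: mx_smooth_on_diff. Qed.

Let pd_J_sym x a b m : U x ->
  pd a (fun y => J y b m) x = pd b (fun y => J y a m) x.
Proof. by move=> Ux; rewrite !J_entry; exact: pd_comm Ux. Qed.

Let phi_diff x : U x -> forall b, differentiable (fun y => phi y 0 b) x.
Proof. by move=> Ux b; exact: smooth_on_diff Ux. Qed.

Let mpd_pull p q (F : V -> 'M[R]_(p, q)) x a : U x ->
  mx_differentiable F (phi x) ->
  mpd a (fun y => F (phi y)) x = \sum_l J x a l *: mpd l F (phi x).
Proof.
move=> Ux dF; rewrite (mpd_comp _ (phi_diff Ux)) //.
by apply: eq_bigr => l _; rewrite mxE.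
Qed.

Let differentiable_pull (g : V -> R) x : U x -> differentiable g (phi x) ->
  differentiable (fun y => g (phi y)) x.
Proof.
move=> Ux dg; have dp := differentiable_row (phi_diff Ux).
exact: differentiable_comp dp dg.
Qed.

Let conn'_diff l x : U x -> mx_differentiable (conn_mx G' l) (phi x).
Proof.
move=> Ux; apply: (@mx_smooth_on_diff _ _ U'); last exact: phi_maps.
exact: mx_smooth_conn.
Qed.

Let conn'_pull_diff l x : U x ->
  mx_differentiable (fun y => conn_mx G' l (phi y)) x.
Proof.
move=> Ux i j; apply: (differentiable_pull (g := fun z => conn_mx G' l z i j)) => //.
exact: conn'_diff.
Qed.

Let pullback_term_diff l a x : U x ->
  mx_differentiable (fun y => J y a l *: conn_mx G' l (phi y)) x.
Proof.
move=> Ux i j; rewrite (_ : (fun y => _) = fun y => J y a l * conn_mx G' l (phi y) i j).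
  by apply: differentiableM; [exact: J_diff|exact: conn'_pull_diff].
by apply/funext => y; rewrite mxE.
Qed.

Let pullback_diff a x : U x -> mx_differentiable (pullback a) x.
Proof.
move=> Ux i j.
rewrite (_ : (fun y => _) = fun y => \sum_l (J y a l *: conn_mx G' l (phi y)) i j).
  by apply: differentiable_bigsum => l; exact: pullback_term_diff.
by apply/funext => y; rewrite summxE.
Qed.

(** The Christoffel law read as a gauge transformation by the Jacobian. *)
Lemma conn_mx_law x a : U x ->
  conn_mx G a x *m J x = mpd a J x + J x *m pullback a x.
Proof.
move=> Ux; apply/matrixP => b k; rewrite mxD_entry mpdE -[RHS]addr0 ?addr0.
rewrite [LHS]mxE [in RHS](mxE _ _ b k).
under eq_bigr do rewrite mxE.
rewrite law //; congr (_ + _); rewrite exchange_big /=; apply: eq_bigr => m _.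
rewrite /pullback summxE mulr_sumr; apply: eq_bigr => l _.
by rewrite !mxE; ring.
Qed.

Let mpd_pullback a b x : U x -> mpd a (pullback b) x =
  \sum_m pd a (fun y => J y b m) x *: conn_mx G' m (phi x)
  + \sum_l \sum_m (J x a l * J x b m) *: mpd l (conn_mx G' m) (phi x).
Proof.
move=> Ux; rewrite mpd_sum => [|l]; last exact: pullback_term_diff.
rewrite [in RHS]exchange_big -big_split /=; apply: eq_bigr => m _.
rewrite mpdZ; [|exact: J_diff|exact: conn'_pull_diff].
rewrite mpd_pull //; last exact: conn'_diff.
rewrite scaler_sumr; congr (_ + _); apply: eq_bigr => l _.
by rewrite scalerA mulrC.
Qed.

(** Naturality of curvature: derivatives of the Jacobian contribute second partials of [phi], which
    are symmetric in a and b and cancel. *)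
Let curv_pullback a b x : U x ->
  mpd a (pullback b) x - mpd b (pullback a) x
    + pullback b x *m pullback a x - pullback a x *m pullback b x
  = \sum_l \sum_m (J x a l * J x b m) *: curv G' l m (phi x).
Proof.
move=> Ux; rewrite !mpd_pullback //.
have -> : \sum_m pd a (fun y => J y b m) x *: conn_mx G' m (phi x) =
          \sum_m pd b (fun y => J y a m) x *: conn_mx G' m (phi x).
  by apply: eq_bigr => m _; rewrite pd_J_sym.
rewrite opprD addrACA subrr add0r.
have mulE c d : pullback c x *m pullback d x = \sum_l \sum_m
    (J x d l * J x c m) *: (conn_mx G' m (phi x) *m conn_mx G' l (phi x)).
  rewrite /pullback mulmx_suml exchange_big; apply: eq_bigr => m _.
  rewrite mulmx_sumr; apply: eq_bigr => l _.
  by rewrite -scalemxAl -scalemxAr scalerA mulrC.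
rewrite mulE [pullback a x *m _]mulE.
rewrite [X in _ - X + _ - _]exchange_big [X in _ + _ - X]exchange_big /=.
rewrite -!sumrB -big_split -sumrB /=; apply: eq_bigr => l _.
rewrite -!sumrB -big_split -sumrB /=; apply: eq_bigr => m _.
by rewrite (mulrC (J x b m)) -scalerBr -scalerDr -scalerBr curvE.
Qed.

(** Differentiating the gauge law and antisymmetrising removes the second derivatives of J; its
    first derivatives are eliminated by the gauge law itself. *)
Lemma curv_law x a b : U x -> curv G a b x *m J x =
  J x *m \sum_l \sum_m (J x a l * J x b m) *: curv G' l m (phi x).
Proof.
move=> Ux; have dJ := J_diff Ux.
have dA c : mx_differentiable (conn_mx G c) x.
  by apply: mx_smooth_on_diff Ux; exact: mx_smooth_conn.
have dPJ c : mx_differentiable (mpd c J) x.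
  by apply: mx_smooth_on_diff Ux; exact: mx_smooth_on_pd.
have D c d : mpd c (conn_mx G d) x *m J x + conn_mx G d x *m mpd c J x =
    mpd c (mpd d J) x + (mpd c J x *m pullback d x + J x *m mpd c (pullback d) x).
  rewrite -!mpdM //; last exact: pullback_diff.
  rewrite -mpdD //; last first.
    move=> i j; rewrite (_ : (fun y => _) =
       fun y => \sum_k J y i k * pullback d y k j).
      apply: differentiable_bigsum => k.
      by apply: differentiableM; [exact: dJ|exact: pullback_diff].
    by apply/funext => y; rewrite mxE.
  by apply: mpd_eq_on Ux => // y Uy; exact: conn_mx_law.
have E c : mpd c J x = conn_mx G c x *m J x - J x *m pullback c x.
  by rewrite conn_mx_law // addrK.
rewrite -curv_pullback // curvE.
have {}D c d : mpd c (conn_mx G d) x *m J x = mpd c (mpd d J) x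
    + (mpd c J x *m pullback d x + J x *m mpd c (pullback d) x)
    - conn_mx G d x *m mpd c J x by rewrite -D addrK.
rewrite mulmxBl mulmxDl mulmxBl (D a b) (D b a).
rewrite (mpd_comm b a U_open J_smooth Ux) (E a) (E b).
by mx_ring.
Qed.

Hypothesis G_sym : forall x, U x -> forall a b c, G a b c x = G b a c x.
Hypothesis G'_sym : forall x, U' x -> forall a b c, G' a b c x = G' b a c x.
Hypothesis J_unit : forall x, U x -> J x \in unitmx.

Lemma ricci_law x : U x ->
  ricci_mx G x = J x *m ricci_mx G' (phi x) *m (J x)^T.
Proof.
move=> Ux; apply/matrixP => a d; set K := invmx (J x).
have C b : curv G b a x = J x *m (\sum_l \sum_m (J x b l * J x a m)
    *: curv G' l m (phi x)) *m K.
  by rewrite -curv_law // -mulmxA mulmxV ?mulmx1 // J_unit.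
rewrite mxE ricciE; last exact: G_sym.
(* T is the Ricci contraction in the target chart; the Jacobian factor of the contracted label b
   meets the conjugating inverse K and cancels. *)
pose T m p : R := \sum_l curv G' l m (phi x) p l.
have -> : \sum_b curv G b a x d b = \sum_m \sum_p J x a m * J x d p * T m p.
  transitivity (\sum_b \sum_q \sum_l \sum_m
      (K q b * J x b l) * (J x a m * (J x *m curv G' l m (phi x)) d q)).
    apply: eq_bigr => b _; rewrite C mxE; apply: eq_bigr => q _.
    rewrite mulmx_sumr summxE mulr_suml; apply: eq_bigr => l _.
    rewrite mulmx_sumr summxE mulr_suml; apply: eq_bigr => m _.
    by rewrite -scalemxAr mxZ_entry; ring.
  rewrite exchange_big /=.
  transitivity (\sum_q \sum_m J x a m * (J x *m curv G' q m (phi x)) d q).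
    apply: eq_bigr => q _.
    transitivity (\sum_l \sum_m (K *m J x) q l *
        (J x a m * (J x *m curv G' l m (phi x)) d q)).
      rewrite exchange_big; apply: eq_bigr => l _.
      rewrite exchange_big; apply: eq_bigr => m _.
      by rewrite -mulr_suml; congr (_ * _); rewrite mxE.
    rewrite (bigD1 q) //= [X in _ + X]big1 ?addr0 => [|l lq].
      by apply: eq_bigr => m _; rewrite mulVmx ?J_unit // mxE eqxx mul1r.
    apply: big1 => m _; rewrite mulVmx ?J_unit // mxE eq_sym (negbTE lq).
    by rewrite mul0r.
  rewrite exchange_big; apply: eq_bigr => m _.
  under eq_bigr do rewrite [(_ *m _) _ _]mxE mulr_sumr.
  rewrite exchange_big; apply: eq_bigr => p _.
  by rewrite /T mulr_sumr; apply: eq_bigr => l _; ring.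
rewrite mxE.
under [RHS]eq_bigr do rewrite [(_ *m _) _ _]mxE [(J x)^T _ _]mxE mulr_suml.
rewrite exchange_big; apply: eq_bigr => m _; apply: eq_bigr => p _.
rewrite [ricci_mx _ _ _ _]mxE ricciE; first by rewrite /T; ring.
by apply: G'_sym; exact: phi_maps.
Qed.

Variables (w : R) (f : V -> R) (mu mu' : V -> V).
Hypothesis f_diff : forall x, U x -> differentiable f x.
Hypothesis mu_diff : forall x, U x -> mx_differentiable mu x.
Hypothesis mu'_diff : forall x, U' x -> mx_differentiable mu' x.
Hypothesis mu_law : forall x, U x -> mu' (phi x) = f x *: (mu x *m J x).
Hypothesis pd_f : forall x, U x -> forall a, pd a f x =
  f x * (weight_term G w a x - \sum_l J x a l * weight_term G' w l (phi x)).

Let row_nabla_mx H m x a : row a (nabla_mx H w m x) =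
  mpd a m x + m x *m conn_mx H a x + weight_term H w a x *: m x.
Proof.
apply/rowP => b; rewrite 2!mxE /nabla_w1 2!mxD_entry mxZ_entry mpdE.
rewrite [(_ *m _) _ _]mxE; congr (_ + _ + _).
by apply: eq_bigr => d _; rewrite mxE mulrC.
Qed.

(** Here [f] is the transition factor of the weight: by [pd_f] its derivative absorbs the difference
    of the two weight terms. *)
Lemma nabla_vec_law x : U x ->
  f x *: (nabla_mx G w mu x *m J x) = J x *m nabla_mx G' w mu' (phi x).
Proof.
move=> Ux; apply/row_matrixP => a.
rewrite linearZ /= !row_mul row_nabla_mx.
have -> : row a (J x) *m nabla_mx G' w mu' (phi x) =
    \sum_l J x a l *: (mpd l mu' (phi x) + mu' (phi x) *m conn_mx G' l (phi x)
       + weight_term G' w l (phi x) *: mu' (phi x)).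
  rewrite mulmx_sum_row; apply: eq_bigr => l _.
  by rewrite row_nabla_mx mxE.
under eq_bigr do rewrite 2!scalerDr scalemxAr scalerA.
rewrite 2!big_split /= -mulmx_sumr -scaler_suml -/(pullback a x).
rewrite -mpd_pull //; last by apply: mu'_diff; exact: phi_maps.
have -> : mpd a (fun y => mu' (phi y)) x =
    mpd a (fun y => f y *: (mu y *m J y)) x.
  by apply: mpd_eq_on Ux => // y Uy; exact: mu_law.
have dmu := mu_diff Ux; have dJ := J_diff Ux.
rewrite mpdZ; [|exact: f_diff|]; last first.
  move=> i j; rewrite (_ : (fun y => _) = fun y => \sum_k mu y i k * J y k j).
    apply: differentiable_bigsum => k.
    by apply: differentiableM; [exact: dmu|exact: dJ].
  by apply/funext => y; rewrite mxE.
rewrite mpdM // pd_f // mu_law //.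
have -> : mpd a J x = conn_mx G a x *m J x - J x *m pullback a x.
  by rewrite conn_mx_law // addrK.
by mx_ring.
Qed.

(** Up to the factor [f], the Jacobian conjugates one covariant derivative into the other. *)
Lemma div_law x : U x ->
  \tr (nabla_mx G' w mu' (phi x)) = f x * \tr (nabla_mx G w mu x).
Proof.
move=> Ux.
have -> : nabla_mx G' w mu' (phi x) =
    invmx (J x) *m (f x *: (nabla_mx G w mu x *m J x)).
  by rewrite nabla_vec_law // mulKmx // J_unit.
by rewrite mxtrace_mulC -scalemxAl -mulmxA mulmxV ?J_unit // mulmx1 mxtraceZ.
Qed.

End CoordinateChange.

(** * Derivatives of the Jacobian determinant and of density transition factors *)

Section WeightFactor.
Context {R : realType} {n : nat}.
Local Notation V := 'rV[R]_n.

Lemma pd_comp1 (g : R -> R) (f : V -> R) a x :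
  differentiable f x -> derivable g (f x) 1 ->
  pd a (fun y => g (f y)) x = pd a f x * 'D_1 g (f x).
Proof.
move=> df /derivable1_diffP dg.
rewrite pd_diff; last exact: differentiable_comp.
have /(congr1 (fun h => h (delta_mx 0 a))) := diff_comp df dg.
rewrite /comp => ->; rewrite (pd_diff a df) deriveE //.
set h := 'd f x _; rewrite [in LHS](_ : h = h *: (1 : R)) ?linearZ //.
by rewrite /GRing.scale /= mulr1.
Qed.

Variables (U U' : set V) (phi : V -> V) (G G' : @christoffel R n).
Variables (e e' : V -> R) (w : R).
Hypothesis U_open : open U.
Hypothesis phi_maps : forall x, U x -> U' (phi x).
Hypothesis phi_diff :
  forall x, U x -> forall b, differentiable (fun y => phi y 0 b) x.

Let J := jacobian phi.

Hypothesis det_gt0 : forall x, U x -> 0 < \det (J x).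
Hypothesis e_diff : forall x, U x -> differentiable e x.
Hypothesis e'_diff : forall x, U' x -> differentiable e' x.
Hypothesis e'_neq0 : forall x, U' x -> e' x != 0.
Hypothesis e_law : forall x, U x -> e x = \det (J x) * e' (phi x).
Hypothesis e_parallel : forall x, U x -> forall a, nabla_form G e a x = 0.
Hypothesis e'_parallel : forall x, U' x -> forall a, nabla_form G' e' a x = 0.

Let e'_pull_diff x : U x -> differentiable (fun y => e' (phi y)) x.
Proof.
move=> Ux; have dp := differentiable_row (phi_diff Ux).
by apply: differentiable_comp dp _; apply: e'_diff; exact: phi_maps.
Qed.

(** Writing the determinant as a quotient of volume forms gives its differentiability and, by
    parallelism, its derivative, in place of Jacobi's formula. *)
Let detE x : U x -> e x * (e' (phi x))^-1 = \det (J x).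
Proof. by move=> Ux; rewrite e_law // mulfK // e'_neq0 //; exact: phi_maps. Qed.

Let quotient_diff x : U x ->
  differentiable (fun y => e y * (e' (phi y))^-1) x.
Proof.
move=> Ux; apply: differentiableM; first exact: e_diff.
by apply: differentiableV; [exact: e'_pull_diff|apply: e'_neq0; exact: phi_maps].
Qed.

Let det_diff x : U x -> differentiable (fun y => \det (J y)) x.
Proof.
by move=> Ux; apply: (differentiable_eq_on U_open detE Ux); exact: quotient_diff.
Qed.

Lemma pd_det x a : U x -> pd a (fun y => \det (J y)) x =
  \det (J x) * (\sum_c G a c c x - \sum_l J x a l * \sum_c G' l c c (phi x)).
Proof.
move=> Ux; rewrite -(pd_eq_on a U_open detE Ux).
have e'0 := e'_neq0 (phi_maps Ux); have de' := e'_pull_diff Ux.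
have dV : differentiable (fun y => (e' (phi y))^-1) x by exact: differentiableV.
rewrite pdM //; last exact: e_diff.
rewrite pdV // (pd_comp a (phi_diff Ux) (e'_diff (phi_maps Ux))).
move/eqP: (e_parallel Ux a); rewrite subr_eq0 => /eqP ->.
have -> : \sum_l pd a (fun y => phi y 0 l) x * pd l e' (phi x) =
    (\sum_l J x a l * \sum_c G' l c c (phi x)) * e' (phi x).
  rewrite mulr_suml; apply: eq_bigr => l _.
  move/eqP: (e'_parallel (phi_maps Ux) l); rewrite subr_eq0 => /eqP ->.
  by rewrite [J x a l]mxE mulrA.
by rewrite e_law //; field.
Qed.

Lemma differentiable_weight_factor x : U x ->
  differentiable (fun y => \det (J y) `^ (w / n.+1%:R)) x.
Proof.
move=> Ux; apply: (differentiable_comp (f := fun y => \det (J y))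
  (g := fun t : R => t `^ (w / n.+1%:R))); first exact: det_diff.
apply/derivable1_diffP; apply: derivable_powR.
by rewrite in_itv /= andbT det_gt0.
Qed.

Lemma pd_weight_factor x a : U x ->
  pd a (fun y => \det (J y) `^ (w / n.+1%:R)) x =
  \det (J x) `^ (w / n.+1%:R) *
  (weight_term G w a x - \sum_l J x a l * weight_term G' w l (phi x)).
Proof.
move=> Ux; set k := w / n.+1%:R; have D0 := det_gt0 Ux.
rewrite (pd_comp1 a (g := fun t : R => t `^ k)); [|exact: det_diff|]; last first.
  by apply: derivable_powR; rewrite in_itv /= andbT.
have [_ ->] := is_derive1_powR k D0; rewrite pd_det //.
have -> : \sum_l J x a l * weight_term G' w l (phi x) =
    k * \sum_l J x a l * \sum_c G' l c c (phi x).
  by rewrite mulr_sumr; apply: eq_bigr => l _; rewrite /weight_term -/k; ring.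
(* The power rule lowers the exponent to k - 1; [pd_det] returns the missing factor of the
   determinant. *)
rewrite /weight_term -/k powRB; last by rewrite (gt_eqF D0); apply: implybT.
by rewrite powRr1 ?ltW //; field; rewrite gt_eqF.
Qed.

End WeightFactor.

Ltac mx_smooth := repeat first
  [ assumption | match goal with |- forall _, _ => intro end
  | apply: mx_smooth_onD | apply: mx_smooth_onN | apply: mx_smooth_onM
  | apply: mx_smooth_onZ | apply: mx_smooth_on_sum | apply: mx_smooth_on_cst
  | apply: mx_smooth_on_pd | apply: smooth_curv | apply: mx_smooth_conn
  | solve [auto] ].

(** * Bianchi identities *)

Section Prolongation.
Context {R : realType} {n : nat}.
Local Notation V := 'rV[R]_n.
Variables (U : set V) (G : @christoffel R n).
Hypothesis U_open : open U.
Hypothesis G_smooth : forall a b c, smooth_on U (G a b c).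
Hypothesis G_sym : forall x, U x -> forall a b c, G a b c x = G b a c x.

Let A := conn_mx G.
Let F := curv G.

Let A_smooth a : mx_smooth_on U (A a).
Proof. exact: mx_smooth_conn. Qed.

Let F_smooth a b : mx_smooth_on U (F a b).
Proof. exact: smooth_curv. Qed.

(** The quadratic terms form a matrix commutator, of zero trace. *)
Lemma tr_curv a b x : U x -> \tr (curv G a b x) =
  pd a (fun y => \sum_c G b c c y) x - pd b (fun y => \sum_c G a c c y) x.
Proof.
move=> Ux; rewrite curvE.
have tr_pd c d : \tr (mpd c (conn_mx G d) x) = pd c (fun y => \sum_e G d e e y) x.
  rewrite pd_sum => [|i]; last exact: smooth_on_diff Ux.
  by apply: eq_bigr => i _; rewrite mpd_conn.
rewrite -addrA linearD linearB /= !tr_pd linearB /=.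
by rewrite mxtrace_mulC subrr addr0.
Qed.

(** Bianchi identity of the matrix connection, with a, b, c as labels: [DF] lets the connection act
    on matrix indices only. Second derivatives cancel in pairs, cubic terms by the Jacobi
    identity. *)
Lemma second_bianchi a b c x : U x ->
  let DF e H := mpd e H x + H x *m conn_mx G e x - conn_mx G e x *m H x in
  DF a (curv G b c) + DF b (curv G c a) + DF c (curv G a b) = 0.
Proof.
move=> Ux DF.
have dif p q (H : V -> 'M[R]_(p, q)) : mx_smooth_on U H -> mx_differentiable H x.
  by move=> sH; exact: mx_smooth_on_diff Ux.
have E e f g : mpd e (curv G f g) x =
    mpd e (mpd f (A g)) x - mpd e (mpd g (A f)) x
    + (mpd e (A g) x *m A f x + A g x *m mpd e (A f) x)
    - (mpd e (A f) x *m A g x + A f x *m mpd e (A g) x).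
  rewrite (mpd_eq_on (H := fun y => mpd f (A g) y - mpd g (A f) y
     + A g y *m A f y - A f y *m A g y) e U_open (fun y _ => curvE G f g y) Ux).
  rewrite mpdD ?mpdN ?mpdD ?mpdN ?mpdM //; by apply: dif; mx_smooth.
rewrite /DF !E !curvE -/A.
rewrite (mpd_comm b a U_open (A_smooth c) Ux) (mpd_comm c a U_open (A_smooth b) Ux).
rewrite (mpd_comm c b U_open (A_smooth a) Ux).
move: (mpd a (mpd b _) x) (mpd a (mpd c _) x) (mpd b (mpd c _) x).
move: (mpd a (A b) x) (mpd a (A c) x) (mpd b (A a) x) (mpd b (A c) x)
  (mpd c (A a) x) (mpd c (A b) x) (A a x) (A b x) (A c x).
by move=> *; mx_ring.
Qed.

(** With row index d as the third lower index, this is the cyclic identity that torsion-freeness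
    imposes. *)
Lemma first_bianchi a b c d x : U x -> curv G a b x d c + curv G b d x a c
  + curv G d a x b c = 0.
Proof.
move=> Ux; have S e f g h : pd e (G f g h) x = pd e (G g f h) x.
  by apply: (pd_eq_on e U_open _ Ux) => y Uy; exact: G_sym.
have M e f g h : (conn_mx G e x *m conn_mx G f x) g h =
    \sum_k G g e k x * G f k h x.
  by rewrite mxE; apply: eq_bigr => k _; rewrite !mxE (G_sym Ux e g).
rewrite !curvE !(mxD_entry, mxN_entry) !mpd_conn !M.
have Q e f g : \sum_k G e f k x * G g k c x = \sum_k G f e k x * G g k c x.
  by apply: eq_bigr => k _; rewrite (G_sym Ux e f).
rewrite (S a b) (S b a) (S d a) (S a d) (S d b) (S b d).
rewrite (Q d b) (Q d a) (Q a b).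
by ring.
Qed.

(** Contracting the first Bianchi identity turns the skew part of Ricci into a trace of curvature,
    which closedness kills. *)
Lemma ricci_sym a d x : U x ->
  (forall a b, pd a (fun y => \sum_c G b c c y) x
             = pd b (fun y => \sum_c G a c c y) x) ->
  ricci G a d x = ricci G d a x.
Proof.
move=> Ux closed; rewrite !ricciE; try exact: G_sym.
apply/eqP; rewrite -subr_eq0 -sumrB.
rewrite (eq_bigr (fun b => - curv G a d x b b)) => [|b _].
  by rewrite sumrN -/(\tr _) tr_curv // closed subrr oppr0.
have := first_bianchi b a b d Ux; rewrite (curvC G d b) mxN_entry => H.
by apply/eqP; rewrite -subr_eq0 -H; apply/eqP; ring.
Qed.

End Prolongation.

Lemma tr_mul_row (R : pzRingType) n (u v : 'rV[R]_n) i j :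
  (u^T *m v) i j = u 0 i * v 0 j.
Proof. by rewrite mxE big_ord1 mxE. Qed.

Lemma row_entry (R : pzRingType) p q (A : 'M[R]_(p, q)) i j k :
  row i A k j = A i j.
Proof. by rewrite mxE. Qed.

Lemma sum_delta_l (R : realType) n (a : 'I_n) (f : 'I_n -> R) :
  \sum_b delta a b * f b = f a.
Proof.
rewrite (bigD1 a) //= /delta eqxx mul1r big1 ?addr0 // => b /negbTE ba.
by rewrite eq_sym ba mul0r.
Qed.

(** * The prolonged system in a chart *)

Section Metrizability.
Context {R : realType} {n : nat}.
Local Notation V := 'rV[R]_n.
Variables (U : set V) (G : @christoffel R n) (w : R).
Hypothesis U_open : open U.
Hypothesis G_smooth : forall a b c, smooth_on U (G a b c).
Hypothesis G_sym : forall x, U x -> forall a b c, G a b c x = G b a c x.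
Hypothesis trace_closed : forall x, U x -> forall a b,
  pd a (fun y => \sum_c G b c c y) x = pd b (fun y => \sum_c G a c c y) x.

Let A := conn_mx G.
Let F := curv G.
Let omega a := weight_term G w a.
(** The identity tensor, one row for each label a. *)
Let theta a : V := delta_mx 0 a.

Let A_smooth a : mx_smooth_on U (A a).
Proof. exact: mx_smooth_conn. Qed.

Let F_smooth a b : mx_smooth_on U (F a b).
Proof. exact: smooth_curv. Qed.

Let trace_smooth a : smooth_on U (fun y => \sum_c G a c c y).
Proof. by apply: smooth_on_sum. Qed.

Let omega_smooth a : smooth_on U (omega a).
Proof. by apply: smooth_onM => //; exact: smooth_on_cst. Qed.

Let dif p q (H : V -> 'M[R]_(p, q)) x :
  U x -> mx_smooth_on U H -> mx_differentiable H x.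
Proof. by move=> Ux sH; exact: mx_smooth_on_diff Ux. Qed.

Let omega_diff a x : U x -> differentiable (omega a) x.
Proof. by move=> Ux; exact: smooth_on_diff Ux. Qed.

Let omega_closed a b x : U x -> pd a (omega b) x = pd b (omega a) x.
Proof.
move=> Ux.
have E c d : pd c (omega d) x = w / n.+1%:R * pd c (fun y => \sum_e G d e e y) x.
  rewrite /omega /weight_term pdM; [|exact: differentiable_cst|].
    by rewrite pd_cst mul0r add0r.
  exact: smooth_on_diff Ux.
by rewrite !E trace_closed.
Qed.

(** Torsion-freeness in row form: under antisymmetrisation the connection terms of the identity
    tensor cancel. *)
Let theta_sym a b x : U x -> theta a *m A b x = theta b *m A a x.
Proof. by move=> Ux; rewrite -!rowE; apply/rowP => i; rewrite !mxE G_sym. Qed.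

(* Covariant derivative of rows of weighted vectors: the differentiation index
   [a] is a label, and only the vector index sees the connection. *)
Let D a (v : V -> V) x : V := mpd a v x + v x *m A a x + omega a x *: v x.

Let D_smooth a (v : V -> V) : mx_smooth_on U v -> mx_smooth_on U (D a v).
Proof. by move=> sv; rewrite /D; mx_smooth. Qed.

Let D_eq_on a (v v' : V -> V) x : (forall y, U y -> v y = v' y) -> U x ->
  D a v x = D a v' x.
Proof. by move=> vv' Ux; rewrite /D (mpd_eq_on a U_open vv' Ux) vv'. Qed.

(** The weight would contribute the exterior derivative of [omega], the curvature of the density
    bundle, which is zero. *)
Let D_comm a b (v : V -> V) x : mx_smooth_on U v -> U x ->
  D a (D b v) x - D b (D a v) x = v x *m F a b x.
Proof.
move=> sv Ux.
have E c d : mpd c (D d v) x = mpd c (mpd d v) x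
    + (mpd c v x *m A d x + v x *m mpd c (A d) x)
    + (pd c (omega d) x *: v x + omega d x *: mpd c v x).
  rewrite -mpdM; [|exact: dif|exact: dif].
  rewrite -mpdZ; [|exact: omega_diff|exact: dif].
  rewrite -mpdD; [|by apply: dif => //; mx_smooth|by apply: dif => //; mx_smooth].
  by rewrite -mpdD; [|by apply: dif => //; mx_smooth|by apply: dif => //; mx_smooth].
rewrite /D -/(D a v) -/(D b v) !E /F curvE -/A (mpd_comm b a U_open sv Ux).
rewrite (omega_closed b a Ux).
move: (mpd a (mpd b v) x) (mpd a v x) (mpd b v x) (v x) (mpd a (A b) x).
move: (mpd b (A a) x) (A a x) (A b x) (omega a x) (omega b x) (pd a _ x).
by move=> *; mx_ring.
Qed.

Variables (sigma : V -> 'M[R]_n) (mu : V -> V).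
Hypothesis sigma_smooth : mx_smooth_on U sigma.
Hypothesis sigma_sym : forall x b c, sigma x b c = sigma x c b.
Hypothesis mu_smooth : mx_smooth_on U mu.
Hypothesis metrizable : forall x, U x -> forall a b c,
  nabla_w2 G w sigma a b c x = delta a b * mu x 0 c + delta a c * mu x 0 b.

Let H a x : 'M[R]_n := (theta a)^T *m mu x + (mu x)^T *m theta a.

Let H_entry a x b c : H a x b c = delta a b * mu x 0 c + delta a c * mu x 0 b.
Proof.
by rewrite !mxE !big_ord1 !mxE !eqxx /delta /= ![_ == a]eq_sym [mu x 0 b * _]mulrC.
Qed.

Let sigma_eq a x : U x -> mpd a sigma x
  + (A a x)^T *m sigma x + sigma x *m A a x + omega a x *: sigma x = H a x.
Proof.
move=> Ux; apply/matrixP => b c; rewrite H_entry -metrizable //.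
rewrite !(mxD_entry, mxZ_entry) mpdE /nabla_w2; congr (_ + _ + _ + _).
  by rewrite mxE; apply: eq_bigr => d _; rewrite !mxE.
by rewrite mxE; apply: eq_bigr => d _; rewrite mxE mulrC.
Qed.

Let mpd_sigma a x : U x -> mpd a sigma x =
  H a x - (A a x)^T *m sigma x - sigma x *m A a x - omega a x *: sigma x.
Proof. by move=> Ux; rewrite -sigma_eq //; mx_ring. Qed.

Let E a := D a mu.

Let sigma_comm a b x : U x ->
  (theta b)^T *m E a x + (E a x)^T *m theta b
  - (theta a)^T *m E b x - (E b x)^T *m theta a =
  (F a b x)^T *m sigma x + sigma x *m F a b x.
Proof.
move=> Ux.
have sAT c : mx_smooth_on U (fun y => (A c y)^T).
  move=> i j; rewrite (_ : (fun y => _) = fun y => A c y j i).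
    exact: A_smooth.
  by apply/funext => y; rewrite mxE.
(* [L] and [Rr] compute the same derivative, from the explicit form of H and from the left side of
   [sigma_eq]; their antisymmetrisations are compared in [C]. *)
have L c d : mpd c (H d) x = (theta d)^T *m mpd c mu x + (mpd c mu x)^T *m theta d.
  rewrite /H mpdD; [|apply: dif => //|apply: dif => //].
  - rewrite mpdM; [|by apply: dif => //; mx_smooth|exact: dif].
    rewrite mpdM; [|by apply: mx_differentiable_tr; exact: dif|
      by apply: dif => //; mx_smooth].
    by rewrite !mpd_cst mpd_tr mul0mx add0r mulmx0 addr0.
  - by mx_smooth.
  - apply: mx_smooth_onM => //; last by mx_smooth.
    move=> i j; rewrite (_ : (fun y => _) = fun y => mu y j i).
      exact: mu_smooth.
    by apply/funext => y; rewrite mxE.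
have Rr c d : mpd c (H d) x = mpd c (mpd d sigma) x
    + ((mpd c (A d) x)^T *m sigma x + (A d x)^T *m mpd c sigma x)
    + (mpd c sigma x *m A d x + sigma x *m mpd c (A d) x)
    + (pd c (omega d) x *: sigma x + omega d x *: mpd c sigma x).
  rewrite -(mpd_eq_on c U_open (fun y => @sigma_eq d y) Ux).
  rewrite mpdD; [|by apply: dif => //; mx_smooth|by apply: dif => //; mx_smooth].
  rewrite mpdD; [|by apply: dif => //; mx_smooth|by apply: dif => //; mx_smooth].
  rewrite mpdD; [|by apply: dif => //; mx_smooth|by apply: dif => //; mx_smooth].
  rewrite mpdM; [|exact: dif|exact: dif].
  rewrite mpdM; [|exact: dif|exact: dif].
  by rewrite mpdZ ?mpd_tr //; [exact: omega_diff|exact: dif].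
have C : mpd a (H b) x - mpd b (H a) x =
    (F a b x)^T *m sigma x + sigma x *m F a b x
    + ((A b x)^T *m H a x + H a x *m A b x + omega b x *: H a x)
    - ((A a x)^T *m H b x + H b x *m A a x + omega a x *: H b x).
  rewrite !Rr !mpd_sigma // (mpd_comm b a U_open sigma_smooth Ux).
  rewrite (omega_closed b a Ux) /F curvE -/A.
  rewrite !(trmxD, trmxN, trmx_mul).
  move: (mpd a (mpd b sigma) x) (sigma x) (mpd a (A b) x) (mpd b (A a) x).
  move: (A a x) (A b x) (omega a x) (omega b x) (pd a _ x) (H a x) (H b x).
  move=> *.
  by mx_ring.
(* Products of [theta] with the connection are symmetric in the labels and drop out. *)
have T : (mu x)^T *m theta a *m A b x = (mu x)^T *m theta b *m A a x.
  by rewrite -mulmxA (theta_sym a b Ux) mulmxA.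
have TT : (A b x)^T *m (theta a)^T *m mu x = (A a x)^T *m (theta b)^T *m mu x.
  by rewrite -!trmx_mul (theta_sym a b Ux).
rewrite !L in C; apply/eqP; rewrite -subr_eq0; apply/eqP.
move: C => /eqP; rewrite -subr_eq0 => /eqP <-.
rewrite /E /D /H !(trmxD, trmxZ, trmx_mul).
rewrite ?(mulmxDl, mulmxDr) ?mulmxA T TT.
move: {T TT L Rr} (F a b x) (sigma x) (mu x) (mpd a mu x) (mpd b mu x).
move: (A a x) (A b x) (omega a x) (omega b x) (theta a) (theta b) => *.
by mx_ring.
Qed.

Let Ric := ricci G.
(** The terms of the first trace: [K] is a row of Ricci, [r] is R_ac^k_d sigma^cd, and [t] is the
    divergence of mu. *)
Let K b x : V := \row_d Ric b d x.
Let r a x : V := \sum_c row c (sigma x) *m F a c x.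
Let t x := \sum_b E b x 0 b.

Let RicE a d x : U x -> Ric a d x = \sum_c F c a x d c.
Proof. by move=> Ux; rewrite /Ric ricciE //; exact: G_sym. Qed.

Let Ric_smooth a d : smooth_on U (Ric a d).
Proof.
apply: (smooth_on_eq U_open (fun y Uy => esym (@RicE a d y Uy))).
by apply: smooth_on_sum => // c; exact: F_smooth.
Qed.

Let RicN a d x : U x -> \sum_c F a c x d c = - Ric a d x.
Proof.
move=> Ux; rewrite RicE // -sumrN; apply: eq_bigr => c _.
by rewrite /F curvC mxN_entry.
Qed.

Let Ric_sym a d x : U x -> Ric a d x = Ric d a x.
Proof.
by move=> Ux; exact: (ricci_sym U_open G_smooth G_sym a d Ux (trace_closed Ux)).
Qed.

Let theta_entry a b : theta a 0 b = delta a b.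
Proof. by rewrite mxE eqxx /= eq_sym. Qed.

Let E_smooth a : mx_smooth_on U (E a).
Proof. exact: D_smooth. Qed.

Let t_smooth : smooth_on U t.
Proof. by apply: smooth_on_sum => // b; exact: E_smooth. Qed.

(** Trace of [sigma_comm] over b and the first matrix index: delta_b^b gives n, and the two other
    copies of [E a] cancel. *)
Let contracted a x : U x ->
  n%:R *: E a x = t x *: theta a - K a x *m sigma x + r a x.
Proof.
move=> Ux; apply/rowP => k.
rewrite 2!mxD_entry mxN_entry 2!mxZ_entry theta_entry.
have entry (b : 'I_n) (u v : V) : ((theta b)^T *m u + u^T *m theta b
    - (theta a)^T *m v - v^T *m theta a) b k = delta b b * u 0 k
    + u 0 b * delta b k - delta a b * v 0 k - v 0 b * delta a k.
  by rewrite !(mxD_entry, mxN_entry, tr_mul_row, theta_entry).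
have : \sum_b ((theta b)^T *m E a x + (E a x)^T *m theta b
    - (theta a)^T *m E b x - (E b x)^T *m theta a) b k
  = \sum_b ((F a b x)^T *m sigma x + sigma x *m F a b x) b k.
  by apply: eq_bigr => b _; rewrite sigma_comm.
under eq_bigr do rewrite entry.
under [X in _ = X -> _]eq_bigr do rewrite mxD_entry.
rewrite !sumrB !big_split /=.
have -> : \sum_(b < n) delta b b * E a x 0 k = n%:R * E a x 0 k.
  rewrite (eq_bigr (fun=> E a x 0 k)) => [|b _]; last first.
    by rewrite /delta eqxx mul1r.
  by rewrite sumr_const card_ord mulr_natl.
have -> : \sum_b E a x 0 b * delta b k = E a x 0 k.
  rewrite -[RHS](sum_delta_l k (fun b => E a x 0 b)).
  by apply: eq_bigr => b _; rewrite mulrC /delta eq_sym.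
have -> : \sum_b E b x 0 b * delta a k = t x * delta a k.
  by rewrite /t mulr_suml.
rewrite sum_delta_l.
have -> : \sum_b ((F a b x)^T *m sigma x) b k = - (K a x *m sigma x) 0 k.
  under eq_bigr do rewrite mxE.
  rewrite exchange_big mxE -sumrN; apply: eq_bigr => d _.
  under eq_bigr do rewrite mxE.
  by rewrite [K _ _ _ _]mxE -mulNr -RicN // mulr_suml.
have -> : \sum_b (sigma x *m F a b x) b k = r a x 0 k.
  rewrite /r summxE; apply: eq_bigr => b _.
  by rewrite -row_mul [RHS]mxE.
by move=> e; rewrite -addrA -e; ring.
Qed.

(** Antisymmetrised derivative of a (1,1)-tensor, traced over the label b and the vector index. The
    connection on the labels may be left out, as its terms cancel in the antisymmetrisation. *)
Let contraction a (X : 'I_n -> V -> V) x :=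
  \sum_b (D a (X b) x - D b (X a) x) 0 b.

Let Ricmu a x := \sum_d Ric a d x * mu x 0 d.

Let contraction_E a x : U x -> contraction a E x = - Ricmu a x.
Proof.
move=> Ux; rewrite /contraction.
under eq_bigr do rewrite D_comm // mxE.
rewrite exchange_big -sumrN; apply: eq_bigr => d _.
by rewrite -[Ric a d x]opprK -RicN // mulNr opprK mulr_suml;
  apply: eq_bigr => b _; rewrite mulrC.
Qed.

Let grad a (f : V -> R) x := pd a f x + omega a x * f x.

Let contraction_theta a x : U x ->
  contraction a (fun b y => t y *: theta b) x = (n%:R - 1) * grad a t x.
Proof.
move=> Ux; rewrite /contraction.
have dt : differentiable t x by exact: smooth_on_diff Ux.
have L b c : D b (fun y => t y *: theta c) x =
    grad b t x *: theta c + t x *: (theta c *m A b x).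
  rewrite /D mpdZ //.
  by rewrite mpd_cst scaler0 addr0 -scalemxAl scalerA scalerDl addrAC.
under eq_bigr do rewrite !L (theta_sym _ _ Ux) opprD addrACA subrr addr0
  mxD_entry mxN_entry !mxZ_entry !theta_entry.
rewrite sumrB mulrBl mul1r; congr (_ - _).
  rewrite (eq_bigr (fun=> grad a t x)) => [|b _]; last first.
    by rewrite /delta eqxx mulr1.
  by rewrite sumr_const card_ord mulr_natl.
by under eq_bigr do rewrite mulrC; rewrite sum_delta_l.
Qed.

Let N a b c x := nabla_cov2 G Ric a b c x.

Let mpd_K a b x d : mpd a (K b) x 0 d = pd a (Ric b d) x.
Proof. by rewrite mpdE; congr (pd _ _ _); apply/funext => y; rewrite mxE. Qed.

Let K_smooth b : mx_smooth_on U (K b).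
Proof.
move=> i j; rewrite (_ : (fun y => _) = Ric b j) //.
by apply/funext => y; rewrite mxE.
Qed.

Let D_K b c x : U x -> D b (fun y => K c y *m sigma y) x =
  (mpd b (K c) x - K c x *m (A b x)^T) *m sigma x + K c x *m H b x.
Proof.
move=> Ux; rewrite /D mpdM; [|exact: dif|exact: dif].
rewrite mpd_sigma //.
by move: (K c x) (mpd b _ x) (A b x)^T => *; mx_ring.
Qed.

Let nabla_K_entry b c d x : (mpd b (K c) x - K c x *m (A b x)^T) 0 d =
  pd b (Ric c d) x - \sum_e G b d e x * Ric c e x.
Proof.
rewrite mxD_entry mxN_entry mpd_K mxE; congr (_ - _).
by apply: eq_bigr => e _; rewrite !mxE mulrC.
Qed.

Let K_H b c d x : (K c x *m H b x) 0 d =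
  Ric c b x * mu x 0 d + delta b d * Ricmu c x.
Proof.
rewrite mxE; under eq_bigr do rewrite H_entry mulrDr.
rewrite big_split /= mulr_sumr; congr (_ + _).
  rewrite -[RHS](sum_delta_l b (fun j => Ric c j x * mu x 0 d)).
  by apply: eq_bigr => j _; rewrite mxE; ring.
by apply: eq_bigr => j _; rewrite mxE; ring.
Qed.

Let contraction_K a x : U x ->
  contraction a (fun b y => K b y *m sigma y) x =
    \sum_b \sum_d (N a b d x - N b a d x) * sigma x d b
    + (1 - n%:R) * Ricmu a x.
Proof.
move=> Ux; rewrite /contraction.
have S b : (D a (fun y => K b y *m sigma y) x
    - D b (fun y => K a y *m sigma y) x) 0 b =
    \sum_d (N a b d x - N b a d x) * sigma x d b
    + (Ric b a x * mu x 0 b + delta a b * Ricmu b x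
       - (Ric a b x * mu x 0 b + delta b b * Ricmu a x)).
  rewrite mxD_entry mxN_entry !D_K // !mxD_entry !K_H opprD addrACA; congr (_ + _).
  rewrite mxE [X in _ - X]mxE -sumrB; apply: eq_bigr => d _.
  rewrite -mulrBl !nabla_K_entry /N /nabla_cov2; congr (_ * _).
  (* [nabla_K_entry] lacks the connection term on the label; in the difference these terms cancel by
     symmetry of G. *)
  have -> : \sum_e G a b e x * Ric e d x = \sum_e G b a e x * Ric e d x.
    by apply: eq_bigr => e _; rewrite G_sym.
  by ring.
under eq_bigr do rewrite S.
rewrite big_split /=; congr (_ + _).
rewrite sumrB !big_split /= sum_delta_l.
have -> : \sum_b Ric b a x * mu x 0 b = Ricmu a x.
  by apply: eq_bigr => b _; rewrite Ric_sym.
have -> : \sum_(b < n) delta b b * Ricmu a x = n%:R * Ricmu a x.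
  rewrite (eq_bigr (fun=> Ricmu a x)) => [|b _]; last first.
    by rewrite /delta eqxx mul1r.
  by rewrite sumr_const card_ord mulr_natl.
by rewrite -/(Ricmu a x); ring.
Qed.

Let DF c a b x := mpd c (F a b) x + F a b x *m A c x - A c x *m F a b x.

(* By the second Bianchi identity this is [- nabla_c F_ab]. *)
Let Z c a b x : 'M[R]_n := DF a b c x - DF b a c x
  - \sum_d (G a c d x *: F b d x - G b c d x *: F a d x).

(** Contracted second Bianchi identity: derivatives along a and b are traded for one along c, which
    commutes with the trace over b and so falls on Ricci. *)
Let tr_Z c a d x : U x -> \sum_b Z c a b x d b = N c a d x.
Proof.
move=> Ux.
have B b : DF a b c x - DF b a c x = - DF c a b x.
  have B := second_bianchi U_open G_smooth a b c Ux.
  have E1 : mpd b (curv G c a) x = - mpd b (curv G a c) x.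
    rewrite -mpdN; last exact: dif.
    by apply: (mpd_eq_on b U_open _ Ux) => y _; exact: curvC.
  move: B; rewrite /= E1 (curvC G c a) /DF /F /A.
  move: (mpd a _ x) (mpd b _ x) (mpd c _ x) (curv G b c x) (curv G a c x).
  move: (curv G a b x) (conn_mx G a x) (conn_mx G b x) (conn_mx G c x).
  by move=> ? ? ? ? ? ? ? ? ? B; apply/eqP; rewrite -subr_eq0 -B; apply/eqP; mx_ring.
have dRic : \sum_b mpd c (F a b) x d b = - pd c (Ric a d) x.
  have -> : \sum_b mpd c (F a b) x d b = pd c (fun y => \sum_b F a b y d b) x.
    rewrite pd_sum => [|b]; last exact: dif.
    by apply: eq_bigr => b _; rewrite mpdE.
  rewrite (pd_eq_on c U_open (fun y Uy => RicN a d Uy) Ux) pdN //.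
  exact: smooth_on_diff Ux.
have S b : Z c a b x d b = - mpd c (F a b) x d b
    + \sum_e G c d e x * F a b x e b - \sum_e F a b x d e * G c e b x
    - \sum_e G a c e x * F b e x d b + \sum_e G b c e x * F a e x d b.
  rewrite /Z B /DF !(mxD_entry, mxN_entry) summxE.
  rewrite (eq_bigr (fun e => G a c e x * F b e x d b - G b c e x * F a e x d b));
    last by move=> e _; rewrite !(mxD_entry, mxN_entry, mxZ_entry).
  rewrite sumrB [(F a b x *m _) d b]mxE [(A c x *m _) d b]mxE.
  under [X in - (_ + X - _)]eq_bigr do rewrite [A c x _ _]mxE.
  under [X in - (_ + _ - X)]eq_bigr do rewrite [A c x _ _]mxE.
  by ring.
under eq_bigr do rewrite S.
rewrite big_split sumrB sumrB big_split sumrN /= dRic opprK.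
have -> : \sum_b \sum_e G c d e x * F a b x e b = - \sum_e G c d e x * Ric a e x.
  rewrite exchange_big -sumrN; apply: eq_bigr => e _.
  by rewrite -mulrN -RicN // mulr_sumr.
have -> : \sum_b \sum_e G a c e x * F b e x d b = \sum_e G c a e x * Ric e d x.
  rewrite exchange_big; apply: eq_bigr => e _.
  by rewrite RicE // mulr_sumr; apply: eq_bigr => b _; rewrite G_sym.
(* The connection terms on the two contracted indices cancel. *)
have -> : \sum_b \sum_e F a b x d e * G c e b x =
    \sum_b \sum_e G b c e x * F a e x d b.
  rewrite exchange_big; apply: eq_bigr => b _; apply: eq_bigr => e _.
  by rewrite mulrC G_sym.
by rewrite /N /nabla_cov2; ring.
Qed.

Let D_r a b x : U x -> D a (r b) x = \sum_c (row c (H a x) *m F b c x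
  + row c (sigma x) *m (DF a b c x - \sum_d G a c d x *: F b d x)).
Proof.
move=> Ux.
have srow c : mx_smooth_on U (fun y => row c (sigma y)).
  move=> i j; rewrite (_ : (fun y => _) = fun y => sigma y c j) //.
  by apply/funext => y; rewrite mxE.
have rowE' c : mpd a (fun y => row c (sigma y)) x = row c (H a x)
    - \sum_d G a d c x *: row d (sigma x) - row c (sigma x) *m A a x
    - omega a x *: row c (sigma x).
  have -> : mpd a (fun y => row c (sigma y)) x = row c (mpd a sigma x).
    apply/rowP => j; rewrite row_entry 2!mpdE; congr (pd _ _ _).
    by apply/funext => y; rewrite row_entry.
  rewrite mpd_sigma // -row_mul; apply/rowP => j; rewrite row_entry.
  rewrite !(mxD_entry, mxN_entry, mxZ_entry) !row_entry; congr (_ - _ - _ - _).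
    by rewrite /H mxD_entry.
  rewrite summxE [LHS]mxE; apply: eq_bigr => d _.
  by rewrite mxZ_entry row_entry; congr (_ * _); rewrite !mxE.
rewrite /D /r mpd_sum => [|c]; last by apply: dif => //; mx_smooth.
rewrite mulmx_suml scaler_sumr -!big_split /=.
rewrite (eq_bigr (fun c => row c (H a x) *m F b c x
    + row c (sigma x) *m DF a b c x
    - \sum_d G a d c x *: (row d (sigma x) *m F b c x))); last first.
  move=> c _; rewrite mpdM; [|exact: dif|exact: dif].
  have alg (h s z : V) (f df Ax : 'M[R]_n) (o : R) :
      (h - z - s *m Ax - o *: s) *m f + s *m df + s *m f *m Ax + o *: (s *m f)
      = h *m f + s *m (df + f *m Ax - Ax *m f) - z *m f by mx_ring.
  rewrite rowE' alg /DF mulmx_suml; congr (_ - _).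
  by apply: eq_bigr => d _; rewrite scalemxAl.
(* Renaming summation indices moves the connection term on the row index of sigma onto the second
   label of F. *)
rewrite sumrB exchange_big -sumrB /=; apply: eq_bigr => c _.
move: (DF a b c x) => W; rewrite (mulmxBr (row c (sigma x)) W) addrA.
congr (_ - _); rewrite mulmx_sumr.
by apply: eq_bigr => d _; rewrite scalemxAr.
Qed.

(** Differentiating sigma yields three copies of R_ad mu^d, two from mu F with the labels in either
    order and one by symmetry of Ricci; the fourth term is a trace of curvature and vanishes. *)
Let contraction_r a x : U x -> contraction a r x =
  \sum_c \sum_d sigma x c d * N c a d x + 3 * Ricmu a x.
Proof.
move=> Ux; rewrite /contraction.
have rowH b c : row c (H b x) = delta b c *: mu x + mu x 0 c *: theta b.
  apply/rowP => j; rewrite mxE H_entry mxD_entry !mxZ_entry theta_entry.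
  by rewrite [delta b j * _]mulrC.
have S b : (D a (r b) x - D b (r a) x) 0 b =
    \sum_c (row c (sigma x) *m Z c a b x) 0 b
    + ((mu x *m F b a x) 0 b + \sum_c mu x 0 c * F b c x a b
      - (mu x *m F a b x) 0 b - \sum_c mu x 0 c * F a c x b b).
  rewrite !D_r // -sumrB summxE.
  rewrite (eq_bigr (fun c => (row c (sigma x) *m Z c a b x) 0 b
    + (delta a c * (mu x *m F b c x) 0 b + mu x 0 c * F b c x a b
      - delta b c * (mu x *m F a c x) 0 b - mu x 0 c * F a c x b b))).
    by rewrite big_split !sumrB big_split /= !sum_delta_l.
  move=> c _; rewrite /Z sumrB !rowH.
  have hM e k (M : 'M[R]_n) : ((delta e c *: mu x + mu x 0 c *: theta e) *m M) 0 k
      = delta e c * (mu x *m M) 0 k + mu x 0 c * M e k.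
    by rewrite mulmxDl mxD_entry -!scalemxAl !mxZ_entry -rowE row_entry.
  have alg (s h h' : V) (f f' X Y S S' : 'M[R]_n) :
      (h *m f + s *m (X - S) - (h' *m f' + s *m (Y - S'))) 0 b
      = (s *m (X - Y - (S - S'))) 0 b + ((h *m f) 0 b - (h' *m f') 0 b).
    by rewrite -mxN_entry -!mxD_entry; congr (fun_of_matrix _ _ _); mx_ring.
  by rewrite alg !hM; ring.
under eq_bigr do rewrite S.
rewrite big_split /=; congr (_ + _).
  rewrite exchange_big; apply: eq_bigr => c _.
  under eq_bigr do rewrite mxE.
  rewrite exchange_big; apply: eq_bigr => d _.
  by rewrite -tr_Z // mulr_sumr; apply: eq_bigr => b _; rewrite mxE.
have m1 : \sum_b (mu x *m F b a x) 0 b = Ricmu a x.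
  under eq_bigr do rewrite mxE.
  rewrite exchange_big; apply: eq_bigr => d _.
  by rewrite RicE // mulr_suml; apply: eq_bigr => b _; rewrite mulrC.
rewrite !sumrB big_split /= m1.
have -> : \sum_b (mu x *m F a b x) 0 b = - Ricmu a x.
  rewrite -m1 -sumrN; apply: eq_bigr => b _.
  by rewrite /F (curvC G a b) mulmxN mxN_entry.
have -> : \sum_b \sum_c mu x 0 c * F b c x a b = Ricmu a x.
  rewrite exchange_big; apply: eq_bigr => c _.
  by rewrite Ric_sym // RicE // mulr_suml; apply: eq_bigr => b _; rewrite mulrC.
have -> : \sum_b \sum_c mu x 0 c * F a c x b b = 0.
  rewrite exchange_big big1 // => c _; rewrite -mulr_sumr.
  by rewrite -/(\tr (F a c x)) /F (tr_curv G_smooth) // trace_closed // subrr mulr0.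
by ring.
Qed.

Let RS y := \sum_b \sum_d Ric b d y * sigma y d b.

Let grad_RS a x : U x ->
  grad a RS x = \sum_b \sum_d N a b d x * sigma x d b + 2 * Ricmu a x.
Proof.
move=> Ux.
have sKs b : mx_smooth_on U (fun y => K b y *m sigma y) by mx_smooth.
have RSE y : RS y = \sum_b (K b y *m sigma y) 0 b.
  by apply: eq_bigr => b _; rewrite mxE; apply: eq_bigr => d _; rewrite mxE.
(* A trace of rows already differentiated in [D_K], less the connection term on the vector index. *)
have -> : grad a RS x = \sum_b (D a (fun y => K b y *m sigma y) x
    - K b x *m sigma x *m A a x) 0 b.
  rewrite /grad (funext RSE) pd_sum => [|b]; last by apply: dif; [|exact: sKs].
  rewrite mulr_sumr -big_split; apply: eq_bigr => b _.
  by rewrite /D mxD_entry mxN_entry !mxD_entry mxZ_entry mpdE /=; ring.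
have S b : (D a (fun y => K b y *m sigma y) x - K b x *m sigma x *m A a x) 0 b
  = \sum_d (pd a (Ric b d) x - \sum_e G a d e x * Ric b e x) * sigma x d b
    - \sum_d \sum_e G a e b x * (Ric b d x * sigma x d e)
    + (Ric b a x * mu x 0 b + delta a b * Ricmu b x).
  rewrite mxD_entry mxN_entry D_K // mxD_entry K_H addrAC; congr (_ - _ + _).
    by rewrite mxE; apply: eq_bigr => d _; rewrite nabla_K_entry.
  rewrite -mulmxA mxE; apply: eq_bigr => d _.
  rewrite [K _ _ _ _]mxE mxE mulr_sumr; apply: eq_bigr => e _.
  by rewrite [A a x _ _]mxE; ring.
under eq_bigr do rewrite S.
rewrite big_split sumrB /= [X in _ + X]big_split /= sum_delta_l.
have -> : \sum_b Ric b a x * mu x 0 b = Ricmu a x.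
  by apply: eq_bigr => b _; rewrite Ric_sym.
have -> : \sum_b \sum_d \sum_e G a e b x * (Ric b d x * sigma x d e)
    = \sum_b \sum_d (\sum_e G a b e x * Ric e d x) * sigma x d b.
  under eq_bigr do rewrite exchange_big.
  rewrite exchange_big; apply: eq_bigr => b _; rewrite exchange_big.
  apply: eq_bigr => d _; rewrite mulr_suml; apply: eq_bigr => e _.
  by rewrite mulrA.
rewrite -sumrB; congr (_ + _); last by ring.
apply: eq_bigr => b _; rewrite -sumrB; apply: eq_bigr => d _.
by rewrite /N /nabla_cov2; ring.
Qed.

Let D_scale a (k : R) (v : V -> V) x : mx_differentiable v x ->
  D a (fun y => k *: v y) x = k *: D a v x.
Proof.
move=> dv; rewrite /D mpdZ //; rewrite pd_cst.
by move: (mpd a v x) (v x) (A a x) (omega a x) => *; mx_ring.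
Qed.

Let D_lin a (u v z : V -> V) x : mx_differentiable u x ->
  mx_differentiable v x -> mx_differentiable z x ->
  D a (fun y => u y - v y + z y) x = D a u x - D a v x + D a z x.
Proof.
move=> du dv dz; rewrite /D.
have dvN : mx_differentiable (fun y => - v y) x.
  move=> i j; rewrite (_ : (fun y => _) = fun y => - v y i j).
    exact: differentiableN.
  by apply/funext => y; rewrite mxE.
rewrite mpdD; [|move=> i j|by []]; last first.
  rewrite (_ : (fun y => _) = fun y => u y i j + (- v y) i j).
    by apply: differentiableD; [exact: du|exact: dvN].
  by apply/funext => y; rewrite mxE.
rewrite mpdD // mpdN //.
move: (mpd a u x) (mpd a v x) (mpd a z x) (u x) (v x) (z x) (A a x) (omega a x).
by move=> *; mx_ring.
Qed.

Let r_smooth a : mx_smooth_on U (r a).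
Proof.
apply: mx_smooth_on_sum => // c; apply: mx_smooth_onM => //.
move=> i j; rewrite (_ : (fun y => _) = fun y => sigma y c j) //.
by apply/funext => y; rewrite row_entry.
Qed.

(** The operation [contraction] applied to [contracted]; 2n + 2 collects n, n - 1 and 3 from the
    individual contractions. *)
Let grad_t a x : U x -> (n%:R - 1) * grad a t x =
  \sum_b \sum_d N a b d x * sigma x d b
  - 2 * \sum_b \sum_d N b a d x * sigma x d b - (2 * n%:R + 2) * Ricmu a x.
Proof.
move=> Ux.
have sth b : mx_smooth_on U (fun y => t y *: theta b) by mx_smooth.
have sKs b : mx_smooth_on U (fun y => K b y *m sigma y) by mx_smooth.
have C : n%:R * contraction a E x =
    contraction a (fun b y => t y *: theta b) x
    - contraction a (fun b y => K b y *m sigma y) x + contraction a r x.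
  rewrite /contraction mulr_sumr -sumrB -big_split; apply: eq_bigr => b _ /=.
  have L c d : n%:R *: D c (E d) x = D c (fun y => t y *: theta d) x
      - D c (fun y => K d y *m sigma y) x + D c (r d) x.
    rewrite -D_lin; [|exact: dif|exact: dif|exact: dif].
    rewrite -D_scale; last exact: dif.
    by apply: D_eq_on Ux => y Uy; exact: contracted.
  rewrite -mxZ_entry scalerBr !L -mxN_entry -!mxD_entry.
  congr (fun_of_matrix _ _ _); move: (D _ _ _) (D _ _ _) (D _ _ _) => *.
  by mx_ring.
move: C; rewrite contraction_E // contraction_theta // contraction_K //.
rewrite contraction_r //.
have -> : \sum_b \sum_d (N a b d x - N b a d x) * sigma x d b =
   \sum_b \sum_d N a b d x * sigma x d b - \sum_b \sum_d N b a d x * sigma x d b.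
  rewrite -sumrB; apply: eq_bigr => b _.
  by rewrite -sumrB; apply: eq_bigr => d _; rewrite mulrBl.
have -> : \sum_c \sum_d sigma x c d * N c a d x =
    \sum_b \sum_d N b a d x * sigma x d b.
  apply: eq_bigr => b _; apply: eq_bigr => d _.
  by rewrite sigma_sym mulrC.
move: (grad a t x) (Ricmu a x) => g m C.
have -> : (n%:R - 1) * g = n%:R * - m + (\sum_b \sum_d N a b d x * sigma x d b
    - \sum_b \sum_d N b a d x * sigma x d b + (1 - n%:R) * m)
    - (\sum_b \sum_d N b a d x * sigma x d b + 3 * m) by rewrite C; ring.
by ring.
Qed.

Hypothesis n_gt1 : (1 < n)%N.

Let n_neq0 : n%:R != 0 :> R.
Proof. by rewrite pnatr_eq0 -lt0n ltnW. Qed.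

Let predn_natr : n.-1%:R = n%:R - 1 :> R.
Proof. by rewrite -subn1 natrB // ltnW. Qed.

Let predn_neq0 : n%:R - 1 != 0 :> R.
Proof. by rewrite -predn_natr pnatr_eq0 -lt0n -subn1 subn_gt0. Qed.

(** The value forced by tracing the second row, the Weyl tensor being trace-free. *)
Definition prolonged_rho y : R := n%:R^-1 *
  (\sum_b nabla_w1 G w mu b b y
   + \sum_b \sum_d schouten G b d y * sigma y d b).

Let E_entry a b y : E a y 0 b = nabla_w1 G w mu a b y.
Proof.
rewrite /E /D 2!mxD_entry mxZ_entry mpdE; congr (_ + _ + _).
by rewrite mxE; apply: eq_bigr => d _; rewrite mxE mulrC.
Qed.

Let rhoE y : prolonged_rho y = n%:R^-1 * (t y + RS y / (n%:R - 1)).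
Proof.
congr (_ * (_ + _)); first by apply: eq_bigr => b _; rewrite E_entry.
rewrite /RS mulr_suml; apply: eq_bigr => b _; rewrite mulr_suml.
by apply: eq_bigr => d _; rewrite /schouten predn_natr /Ric; ring.
Qed.

Lemma smooth_prolonged_rho : smooth_on U prolonged_rho.
Proof.
rewrite (funext rhoE); apply: smooth_onM => //; first exact: smooth_on_cst.
apply: smooth_onD => //; apply: smooth_onM => //; last exact: smooth_on_cst.
by apply: smooth_on_sum => // b; apply: smooth_on_sum => // d; exact: smooth_onM.
Qed.

(** With Weyl split into curvature and Schouten parts, this is [contracted] divided by n. *)
Lemma prolonged_vec a b x : U x -> nabla_w1 G w mu a b x
  - delta a b * prolonged_rho x + \sum_c schouten G a c x * sigma x b c
  = n%:R^-1 * \sum_c \sum_d weyl G a c b d x * sigma x c d.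
Proof.
move=> Ux.
have W : \sum_c \sum_d weyl G a c b d x * sigma x c d = r a x 0 b
    - delta a b * (RS x / (n%:R - 1))
    + (\sum_d Ric a d x * sigma x b d) / (n%:R - 1).
  have -> : r a x 0 b = \sum_c \sum_d F a c x d b * sigma x c d.
    rewrite summxE; apply: eq_bigr => c _; rewrite mxE.
    by apply: eq_bigr => d _; rewrite row_entry mulrC.
  have -> : \sum_d Ric a d x * sigma x b d =
      \sum_c delta c b * \sum_d Ric a d x * sigma x c d.
    rewrite -[LHS](sum_delta_l b (fun c => \sum_d Ric a d x * sigma x c d)).
    by apply: eq_bigr => c _; rewrite /delta eq_sym.
  have -> : delta a b * (RS x / (n%:R - 1)) =
      \sum_c \sum_d delta a b * (Ric c d x * sigma x d c / (n%:R - 1)).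
    rewrite /RS mulr_suml mulr_sumr; apply: eq_bigr => c _.
    by rewrite mulr_suml mulr_sumr.
  have -> : (\sum_c delta c b * \sum_d Ric a d x * sigma x c d) / (n%:R - 1) =
      \sum_c \sum_d delta c b * (Ric a d x * sigma x c d) / (n%:R - 1).
    rewrite mulr_suml; apply: eq_bigr => c _.
    by rewrite mulr_sumr mulr_suml.
  rewrite -sumrB -big_split /=; apply: eq_bigr => c _.
  rewrite -sumrB -big_split /=; apply: eq_bigr => d _.
  rewrite /weyl riemannE; last exact: G_sym.
  by rewrite /schouten predn_natr -/Ric -/F (sigma_sym x d c); ring.
have /rowP/(_ b) := contracted a Ux.
rewrite 2!mxD_entry mxN_entry 2!mxZ_entry theta_entry E_entry => C.
rewrite W rhoE.
have -> : r a x 0 b = n%:R * nabla_w1 G w mu a b x - t x * delta a b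
    + (K a x *m sigma x) 0 b by rewrite C; ring.
have -> : (K a x *m sigma x) 0 b = \sum_d Ric a d x * sigma x b d.
  by rewrite mxE; apply: eq_bigr => d _; rewrite mxE sigma_sym.
have -> : \sum_c schouten G a c x * sigma x b c =
    (\sum_d Ric a d x * sigma x b d) / (n%:R - 1).
  rewrite mulr_suml; apply: eq_bigr => d _.
  by rewrite /schouten predn_natr /Ric; ring.
by field; rewrite n_neq0 predn_neq0.
Qed.

(** In the gradient of (n - 1) t + RS the Ricci terms add up to -2n R_ad mu^d, which cancels 2 P_ab
    mu^b after division by n (n - 1). The derivatives of Ricci remain antisymmetrised with
    coefficient 2, written as 4 because of the half in the Cotton-York tensor. *)
Lemma prolonged_fun a x : U x -> nabla_w0 G w prolonged_rho a x
  + 2 * \sum_b schouten G a b x * mu x 0 b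
  = n%:R^-1 * (4 * \sum_b \sum_c cotton_york G a b c x * sigma x b c).
Proof.
move=> Ux.
have dt : differentiable t x by exact: smooth_on_diff Ux.
have sRS : smooth_on U RS.
  by apply: smooth_on_sum => // b; apply: smooth_on_sum => // d; exact: smooth_onM.
have dRS : differentiable RS x by exact: smooth_on_diff Ux.
have dRSs : differentiable (fun y => RS y / (n%:R - 1)) x.
  by apply: differentiableM.
have g0 : nabla_w0 G w prolonged_rho a x =
    n%:R^-1 * (grad a t x + grad a RS x / (n%:R - 1)).
  rewrite /nabla_w0 (funext rhoE) pdM //; last exact: differentiableD.
  rewrite pd_cst pdD // pdM // pd_cst /grad /omega; ring.
have Nc b c d : nabla_cov2 G (schouten G) b c d x = N b c d x / (n%:R - 1).
  rewrite /N /nabla_cov2.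
  have -> : pd b (schouten G c d) x = pd b (Ric c d) x / (n%:R - 1).
    rewrite /schouten predn_natr pdM //; last exact: smooth_on_diff Ux.
    by rewrite pd_cst mulr0 addr0.
  have Sc e f g : \sum_e0 G b e e0 x * schouten G (f e0) (g e0) x
     = (\sum_e0 G b e e0 x * Ric (f e0) (g e0) x) / (n%:R - 1).
    rewrite mulr_suml; apply: eq_bigr => h _.
    by rewrite /schouten predn_natr /Ric mulrA.
  by rewrite (Sc c id (fun=> d)) (Sc d (fun=> c) id); ring.
have Y : \sum_b \sum_c cotton_york G a b c x * sigma x b c =
  (\sum_b \sum_d N a b d x * sigma x d b - \sum_b \sum_d N b a d x * sigma x d b)
    / (n%:R - 1) / 2.
  rewrite -sumrB !mulr_suml; apply: eq_bigr => b _.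
  rewrite -sumrB !mulr_suml; apply: eq_bigr => d _.
  by rewrite /cotton_york !Nc (sigma_sym x b d); ring.
have P : \sum_b schouten G a b x * mu x 0 b = Ricmu a x / (n%:R - 1).
  rewrite mulr_suml; apply: eq_bigr => d _.
  by rewrite /schouten predn_natr /Ric; ring.
rewrite g0 Y P grad_RS //.
have := grad_t a Ux; move: (grad a t x) (Ricmu a x) => g m e.
have -> : g = ((n%:R - 1) * g) / (n%:R - 1) by field.
rewrite e; by field; rewrite n_neq0 predn_neq0.
Qed.

End Metrizability.

(** * Fields and tractors *)

Section Globalization.
Context {R : realType} {n : nat} (M : oriented_manifold R n).
Local Notation V := 'rV[R]_n.
Local Notation I := (chart_index M).
Implicit Types (D : connection M) (i j : I).

(** The trace of the connection is the logarithmic gradient of the parallel volume form, whose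
    second partials commute. *)
Lemma parallel_trace_closed (U : set V) (G : @christoffel R n) (e : V -> R) :
  open U -> (forall a b c, smooth_on U (G a b c)) ->
  smooth_on U e -> (forall x, U x -> e x != 0) ->
  (forall x, U x -> forall a, nabla_form G e a x = 0) ->
  forall x, U x -> forall a b, pd a (fun y => \sum_c G b c c y) x
    = pd b (fun y => \sum_c G a c c y) x.
Proof.
move=> oU sG se e0 par x Ux a b.
have pde c y : U y -> pd c e y = (\sum_d G c d d y) * e y.
  by move=> Uy; apply/eqP; rewrite -subr_eq0; apply/eqP; exact: par.
have E c d : pd c (pd d e) x = pd c (fun y => \sum_k G d k k y) x * e x
    + (\sum_k G d k k x) * ((\sum_k G c k k x) * e x).
  rewrite (pd_eq_on c oU (fun y Uy => pde d y Uy) Ux) pdM ?pde //.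
    by apply: smooth_on_diff Ux; exact: smooth_on_sum.
  exact: smooth_on_diff Ux.
have := pd_comm a b oU se Ux; rewrite !E => H.
apply: (mulIf (e0 x Ux)).
apply: (addIr ((\sum_k G b k k x) * ((\sum_k G a k k x) * e x))).
by rewrite H; ring.
Qed.

Lemma chart_im_open i : open (chart_im i).
Proof. exact: chart_open. Qed.

Lemma overlap_subset i j : overlap i j `<=` chart_im i.
Proof. by move=> _ [p [pi pj] <-]; exists p. Qed.

Lemma overlap_transition i j x : overlap i j x -> chart_im j (transition i j x).
Proof. by move=> [p [pi pj] <-]; rewrite /transition chartK //; exists p. Qed.

(** [chart_inv] is continuous only relative to the chart image, so the overlap is treated as a
    preimage inside that open set. *)
Lemma overlap_open i j : open (overlap i j).
Proof.
have -> : overlap i j = chart_im i `&` chart_inv i @^-1` dom j.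
  apply/seteqP; split=> x.
    by move=> [p [pi pj] <-]; split; [exists p|rewrite /preimage /= chartK].
  by move=> [[p pi <-]]; rewrite /preimage /= chartK // => pj; exists p.
have := @chart_inv_continuous R n M i.
rewrite continuous_open_subspace; last exact: chart_open.
move=> ci; rewrite openE => x [xi xj].
have xi' : x \in chart i @` dom i by rewrite inE.
apply: filterI; first by apply: open_nbhs_nbhs; split => //; exact: chart_im_open.
apply: (ci x xi'); apply: open_nbhs_nbhs; split => //; exact: dom_open.
Qed.

Lemma jac_unit i j x : overlap i j x -> jac i j x \in unitmx.
Proof. by move=> ox; rewrite unitmxE unitfE gt_eqF // transition_oriented. Qed.

(** Components vanish off the chart image, so agreement on the image is agreement everywhere; the
    other record fields are propositions. *)
Lemma wfun_eq w (u v : wfun M w) :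
  (forall i x, chart_im i x -> u i x = v i x) -> u = v.
Proof.
case: u v => [u su ou lu] [v sv ov lv] /= uv.
have E : u = v.
  apply/funext => i; apply/funext => x.
  by have [/uv //|nx] := pselect (chart_im i x); rewrite ou // ov.
by subst v; congr WFun; exact: Prop_irrelevance.
Qed.

Lemma wvec_eq w (u v : wvec M w) :
  (forall i x, chart_im i x -> forall b, u i x 0 b = v i x 0 b) -> u = v.
Proof.
case: u v => [u su ou lu] [v sv ov lv] /= uv.
have E : u = v.
  apply/funext => i; apply/funext => x.
  have [ix|nx] := pselect (chart_im i x); last by rewrite ou // ov.
  by apply/rowP => b; exact: uv.
by subst v; congr WVec; exact: Prop_irrelevance.
Qed.

Lemma wsym2_eq w (u v : wsym2 M w) :
  (forall i x, chart_im i x -> forall b c, u i x b c = v i x b c) -> u = v.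
Proof.
case: u v => [u su ou yu lu] [v sv ov yv lv] /= uv.
have E : u = v.
  apply/funext => i; apply/funext => x.
  have [ix|nx] := pselect (chart_im i x); last by rewrite ou // ov.
  by apply/matrixP => b c; exact: uv.
by subst v; congr WSym2; exact: Prop_irrelevance.
Qed.

Lemma tractor_eq (P : projective_structure M) (t t' : tractor P) :
  (forall D : special_in P, t D = t' D) -> t = t'.
Proof.
case: t t' => [t ct] [t' ct'] /= tt'.
have E : t = t' by apply/funext.
by subst t'; congr Tractor; exact: Prop_irrelevance.
Qed.

Lemma wsym2_entry_sym w (s : wsym2 M w) i x b c : s i x b c = s i x c b.
Proof. by rewrite -{1}wsym2_sym mxE. Qed.

Lemma proj_change_trace D D' (U : one_form M) i x a : proj_change D D' U ->
  chart_im i x -> n.+1%:R * U i x 0 a =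
    \sum_c conn_comp D' i a c c x - \sum_c conn_comp D i a c c x.
Proof.
move=> ch ix.
(* The d-th coordinate field isolates one diagonal Christoffel symbol; summing over d gives n + 1
   copies of U_a. *)
have E d : conn_comp D' i a d d x = conn_comp D i a d d x
    + (U i x 0 a + delta a d * U i x 0 d).
  have := ch i (fun e _ => delta d e) (fun b => smooth_on_cst _ _) x ix a d.
  have N (G : @christoffel R n) : nabla_vec G (fun e _ => delta d e) a d x = G a d d x.
    rewrite /nabla_vec pd_cst add0r.
    rewrite -[RHS](sum_delta_l d (fun c => G a c d x)).
    by apply: eq_bigr => c _; rewrite mulrC.
  rewrite !N => ->; rewrite -addrA; congr (_ + (_ + _ * _)).
    by rewrite /delta eqxx mulr1.
  rewrite -[RHS](sum_delta_l d (fun c => U i x 0 c)).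
  by apply: eq_bigr => c _; rewrite mulrC.
under eq_bigr do rewrite E.
rewrite big_split big_split /= sum_delta_l sumr_const card_ord.
by rewrite -natr1 -mulr_natl; ring.
Qed.

Lemma proj_change_refl D (U : one_form M) i x :
  proj_change D D U -> chart_im i x -> U i x = 0.
Proof.
move=> ch ix; apply/rowP => a.
apply: (mulfI (x := n.+1%:R)); first by rewrite pnatr_eq0.
by rewrite (proj_change_trace _ ch ix) subrr mxE mulr0.
Qed.

Lemma proj_change_trans D D' D'' (U U' U'' : one_form M) i x :
  proj_change D D' U -> proj_change D' D'' U' -> proj_change D D'' U'' ->
  chart_im i x -> U'' i x = U i x + U' i x.
Proof.
move=> c c' c'' ix; apply/rowP => a; rewrite mxE.
apply: (mulfI (x := n.+1%:R)); first by rewrite pnatr_eq0.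
rewrite mulrDr (proj_change_trace _ c ix) (proj_change_trace _ c' ix).
by rewrite (proj_change_trace _ c'' ix); ring.
Qed.

(** * The action of 1-forms on triples *)

Section ChangeTriple.
Variables (U : one_form M) (s : wsym2 M (-2)) (m : wvec M (-2)) (r : wfun M (-2)).

Let mu' i x : 'rV[R]_n := m i x + U i x *m s i x.

Let rho' i x : R :=
  r i x + 2 * (U i x *m (m i x)^T) 0 0 + (U i x *m s i x *m (U i x)^T) 0 0.

Let smooth_U i : mx_smooth_on (chart_im i) (U i).
Proof. by move=> k b; rewrite (ord1 k); exact: one_form_smooth. Qed.

Let smooth_s i : mx_smooth_on (chart_im i) (s i).
Proof. by move=> b c; exact: wsym2_smooth. Qed.

Let smooth_m i : mx_smooth_on (chart_im i) (m i).
Proof. by move=> k b; rewrite (ord1 k); exact: wvec_smooth. Qed.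

Let smooth_tr i p q (F : V -> 'M[R]_(p, q)) : mx_smooth_on (chart_im i) F ->
  mx_smooth_on (chart_im i) (fun y => (F y)^T).
Proof.
move=> sF b c; rewrite (_ : (fun y => _) = fun y => F y c b) //.
by apply/funext => y; rewrite mxE.
Qed.

Let mu'_smooth i b : smooth_on (chart_im i) (fun x => mu' i x 0 b).
Proof.
have oi : open (chart_im i) by exact: chart_im_open.
have S : mx_smooth_on (chart_im i) (mu' i).
  by apply: mx_smooth_onD => //; apply: mx_smooth_onM.
exact: S.
Qed.

Let mu'_off i x : ~ chart_im i x -> mu' i x = 0.
Proof.
by move=> nx; rewrite /mu' (wvec_off m nx) (wsym2_off s nx) mulmx0 addr0.
Qed.

Let mu'_law i j x : overlap i j x -> mu' j (transition i j x) =
  weight_factor (-2) i j x *: (mu' i x *m jac i j x).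
Proof.
move=> ox; rewrite /mu' (wvec_law m ox) (wsym2_law s ox) (one_form_law U ox).
by rewrite mulmxDl scalerDr -scalemxAr !mulmxA.
Qed.

Let rho'_smooth i : smooth_on (chart_im i) (rho' i).
Proof.
have oi : open (chart_im i) by exact: chart_im_open.
apply: smooth_onD => //; first (apply: smooth_onD => //; first exact: wfun_smooth).
  apply: smooth_onM => //; first exact: smooth_on_cst.
  have S : mx_smooth_on (chart_im i) (fun x => U i x *m (m i x)^T).
    by apply: mx_smooth_onM => //; exact: smooth_tr.
  exact: S.
have S : mx_smooth_on (chart_im i) (fun x => U i x *m s i x *m (U i x)^T).
  by apply: mx_smooth_onM => //; [exact: mx_smooth_onM|exact: smooth_tr].
exact: S.
Qed.

Let rho'_off i x : ~ chart_im i x -> rho' i x = 0.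
Proof.
move=> nx; rewrite /rho' (wfun_off r nx) (wvec_off m nx) (wsym2_off s nx).
by rewrite trmx0 !mulmx0 mul0mx !mxE mulr0 !addr0.
Qed.

Let rho'_law i j x : overlap i j x -> rho' j (transition i j x) =
  weight_factor (-2) i j x * rho' i x.
Proof.
move=> ox; rewrite /rho' (wfun_law r ox) (wvec_law m ox) (wsym2_law s ox).
rewrite (one_form_law U ox); set f := weight_factor _ _ _ _.
rewrite !(trmxZ, trmx_mul) trmxK -!scalemxAr -!scalemxAl !mxZ_entry !mulmxA.
by ring.
Qed.

Definition changed_triple : triple M :=
  (s, WVec mu'_smooth mu'_off mu'_law, WFun rho'_smooth rho'_off rho'_law).

Lemma changed_tripleP : triple_change U (s, m, r) changed_triple.
Proof.
move=> i x ix; split => //= [b|].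
  rewrite /mu' !mxE; congr (_ + _); apply: eq_bigr => c _.
  by rewrite (wsym2_entry_sym s i x c b).
rewrite /rho'; congr (_ + 2 * _ + _).
  by rewrite mxE; apply: eq_bigr => b _; rewrite mxE.
rewrite mxE exchange_big; apply: eq_bigr => c _; rewrite !mxE mulr_suml.
by apply: eq_bigr => b _; ring.
Qed.

End ChangeTriple.

Lemma triple_change_uniq (U : one_form M) (t t1 t2 : triple M) :
  triple_change U t t1 -> triple_change U t t2 -> t1 = t2.
Proof.
case: t t1 t2 => [[s m] r] [[s1 m1] r1] [[s2 m2] r2] /= c1 c2.
congr (_, _, _).
- apply: wsym2_eq => i x ix b c.
  by have [-> _ _] := c1 i x ix; have [-> _ _] := c2 i x ix.
- apply: wvec_eq => i x ix b.
  by have [_ -> _] := c1 i x ix; have [_ -> _] := c2 i x ix.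
- apply: wfun_eq => i x ix.
  by have [_ _ ->] := c1 i x ix; have [_ _ ->] := c2 i x ix.
Qed.

(** The change law is an action of the additive group of 1-forms, which is the consistency a tractor
    needs. *)
Lemma triple_change_add (U U' U'' : one_form M) (t t' t'' : triple M) :
  (forall i x, chart_im i x -> U'' i x = U i x + U' i x) ->
  triple_change U t t' -> triple_change U'' t t'' -> triple_change U' t' t''.
Proof.
case: t t' t'' => [[s m] r] [[s' m'] r'] [[s2 m2] r2] /= UU' c1 c2 i x ix.
have [s1 m1 r1] := c1 i x ix; have [s3 m3 r3] := c2 i x ix.
have E b : U'' i x 0 b = U i x 0 b + U' i x 0 b by rewrite UU' // mxE.
split=> [b c|b|]; first by rewrite s3 s1.
  rewrite m3 m1 -addrA; congr (_ + _); rewrite -big_split; apply: eq_bigr => c _ /=.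
  by rewrite E s1 mulrDl.
rewrite r3 r1.
have E1 : \sum_b U'' i x 0 b * m i x 0 b =
    \sum_b U i x 0 b * m i x 0 b + \sum_b U' i x 0 b * m i x 0 b.
  by rewrite -big_split; apply: eq_bigr => b _; rewrite E mulrDl.
have E2 : \sum_b U' i x 0 b * m' i x 0 b = \sum_b U' i x 0 b * m i x 0 b
    + \sum_b \sum_c U' i x 0 b * (U i x 0 c * s i x b c).
  rewrite -big_split; apply: eq_bigr => b _ /=; rewrite m1 mulrDr; congr (_ + _).
  by rewrite mulr_sumr.
(* The cross term: doubled through mu' on one side, and present in both orders in the quadratic part
   on the other; the orders agree by symmetry of sigma. *)
set Q := \sum_b \sum_c U' i x 0 b * (U i x 0 c * s i x b c) in E2.
have E3 : \sum_b \sum_c U'' i x 0 b * U'' i x 0 c * s i x b c =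
    \sum_b \sum_c U i x 0 b * U i x 0 c * s i x b c + (Q + Q)
    + \sum_b \sum_c U' i x 0 b * U' i x 0 c * s' i x b c.
  have {2}-> : Q = \sum_b \sum_c U i x 0 b * U' i x 0 c * s i x b c.
    rewrite /Q exchange_big; apply: eq_bigr => b _; apply: eq_bigr => c _.
    by rewrite (wsym2_entry_sym s i x c b); ring.
  rewrite -!big_split; apply: eq_bigr => b _ /=.
  rewrite -!big_split; apply: eq_bigr => c _ /=.
  by rewrite !E s1; ring.
by rewrite E1 E2 E3; ring.
Qed.

End Globalization.

(** * Gluing the local values of rho *)

Section ProlongedTractor.
Context {R : realType} {n : nat} (M : oriented_manifold R n).
Hypothesis n_gt1 : (1 < n)%N.
Local Notation V := 'rV[R]_n.
Variables (D : connection M) (e : volume_form M).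
Hypothesis e_parallel : forall i x, chart_im i x ->
  forall a, nabla_form (D i) (e i) a x = 0.
Variables (sigma : wsym2 M (-2)) (mu : wvec M (-2)).
Hypothesis metrizable : forall i x, chart_im i x -> forall a b c,
  nabla_w2 (D i) (-2) (sigma i) a b c x =
    delta a b * mu i x 0 c + delta a c * mu i x 0 b.

Let im_open (i : chart_index M) : open (chart_im i).
Proof. exact: chart_im_open. Qed.

Let D_smooth i a b c : smooth_on (chart_im i) (conn_comp D i a b c).
Proof. exact: conn_smooth. Qed.

Let D_sym i x : chart_im i x -> forall a b c,
  conn_comp D i a b c x = conn_comp D i b a c x.
Proof. by move=> ix a b c; exact: conn_torsion_free. Qed.

Let D_closed i x : chart_im i x -> forall a b,
  pd a (fun y => \sum_c conn_comp D i b c c y) x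
  = pd b (fun y => \sum_c conn_comp D i a c c y) x.
Proof.
apply: (parallel_trace_closed (e := e i)) => //.
- exact: volume_form_smooth.
- by move=> y; exact: volume_form_neq0.
- exact: e_parallel.
Qed.

Let sigma_smooth i : mx_smooth_on (chart_im i) (sigma i).
Proof. by move=> b c; exact: wsym2_smooth. Qed.

Let mu_smooth i : mx_smooth_on (chart_im i) (mu i).
Proof. by move=> k b; rewrite (ord1 k); exact: wvec_smooth. Qed.

Let rho0 i := prolonged_rho (conn_comp D i) (-2) (sigma i) (mu i).

(** In trace form, the Jacobian factors cancel by cyclicity of the trace, leaving only the weight
    factor. *)
Let rho0E i x : rho0 i x = n%:R^-1 * (\tr (nabla_mx (conn_comp D i) (-2) (mu i) x)
  + \tr (ricci_mx (conn_comp D i) x *m sigma i x) / n.-1%:R).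
Proof.
rewrite /rho0 /prolonged_rho; congr (_ * (_ + _)).
  by apply: eq_bigr => b _; rewrite mxE.
rewrite mulr_suml; apply: eq_bigr => b _; rewrite mxE mulr_suml.
by apply: eq_bigr => d _; rewrite mxE /schouten; ring.
Qed.

Let rho0_law i j x : overlap i j x ->
  rho0 j (transition i j x) = weight_factor (-2) i j x * rho0 i x.
Proof.
move=> ox; have oo : open (overlap i j) by exact: overlap_open.
have sub : overlap i j `<=` chart_im i by exact: overlap_subset.
have maps y : overlap i j y -> chart_im j (transition i j y).
  exact: overlap_transition.
have phi_smooth b : smooth_on (overlap i j) (fun y => transition i j y 0 b).
  exact: transition_smooth.
have phi_diff y : overlap i j y ->
    forall b, differentiable (fun z => transition i j z 0 b) y.
  by move=> oy b; exact: smooth_on_diff oy.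
have law y : overlap i j y -> forall a b k,
    \sum_c conn_comp D i a b c y * jacobian (transition i j) y c k =
    pd a (fun z => jacobian (transition i j) z b k) y
    + \sum_l \sum_m jacobian (transition i j) y a l
        * jacobian (transition i j) y b m * conn_comp D j l m k (transition i j y).
  by move=> oy a b k; exact: conn_law.
have sDi a b c : smooth_on (overlap i j) (conn_comp D i a b c).
  exact: smooth_on_subset (D_smooth _ _ _ _).
have ric := ricci_law oo maps phi_smooth sDi (@D_smooth j) law
  (fun y oy => D_sym (sub y oy)) (@D_sym j) (@jac_unit _ _ M i j) ox.
have de y : overlap i j y -> differentiable (e i) y.
  by move=> /sub oy; apply: smooth_on_diff oy; exact: volume_form_smooth.
have de' y : chart_im j y -> differentiable (e j) y.
  by move=> jy; apply: smooth_on_diff jy; exact: volume_form_smooth.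
have e'0 y : chart_im j y -> e j y != 0 by exact: volume_form_neq0.
have det_gt0 y : overlap i j y -> 0 < \det (jacobian (transition i j) y).
  exact: transition_oriented.
have e_law y : overlap i j y ->
    e i y = \det (jacobian (transition i j) y) * e j (transition i j y).
  exact: volume_form_law.
have dw := differentiable_weight_factor (-2) oo maps phi_diff det_gt0 de de' e'0 e_law.
have pdw := pd_weight_factor (-2) oo maps phi_diff det_gt0 de de' e'0 e_law
  (fun y oy => e_parallel (sub y oy)) (@e_parallel j).
have dmu y : overlap i j y -> mx_differentiable (mu i) y.
  by move=> /sub; exact: mx_smooth_on_diff.
have dmu' y : chart_im j y -> mx_differentiable (mu j) y.
  exact: mx_smooth_on_diff.
have div := div_law oo maps phi_smooth law (@jac_unit _ _ M i j) dw dmu dmu'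
  (@wvec_law _ _ _ _ mu i j) (fun y oy a => pdw y a oy) ox.
rewrite !rho0E div (wsym2_law sigma ox) ric.
rewrite -scalemxAr mxtraceZ -/(weight_factor (-2) i j x).
set T' := \tr (ricci_mx (conn_comp D j) _ *m _).
set T := \tr (_ *m sigma i x).
have -> : T' = T by rewrite /T' /T -!mulmxA [RHS]mxtrace_mulC !mulmxA.
by rewrite -/(weight_factor (-2) i j x); ring.
Qed.

(** The coordinate formula is cut off to meet the requirement that components vanish outside the
    chart image. *)
Let rho i x : R := if `[< chart_im i x >] then rho0 i x else 0.

Let rho_in i x : chart_im i x -> rho i x = rho0 i x.
Proof. by move=> ix; rewrite /rho asboolT. Qed.

Let rho_smooth i : smooth_on (chart_im i) (rho i).
Proof.
have E y : chart_im i y -> rho0 i y = rho i y by move=> iy; rewrite rho_in.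
apply: (smooth_on_eq (@im_open i) E).
exact: (smooth_prolonged_rho (-2) (@im_open i) (@D_smooth i) (@D_sym i)
  (@sigma_smooth i) (@mu_smooth i)).
Qed.

Let rho_off i x : ~ chart_im i x -> rho i x = 0.
Proof. by move=> ix; rewrite /rho asboolF. Qed.

Let rho_law i j x : overlap i j x ->
  rho j (transition i j x) = weight_factor (-2) i j x * rho i x.
Proof.
move=> ox; rewrite rho_in; last exact: overlap_transition.
by rewrite rho_in ?rho0_law //; exact: overlap_subset ox.
Qed.

Definition prolonged_triple : triple M :=
  (sigma, mu, WFun rho_smooth rho_off rho_law).

Lemma prolonged_tripleP i x a : chart_im i x ->
  tractor_nabla D prolonged_triple i a x
  - n%:R^-1 *: curvature_term D prolonged_triple i a x = 0 :> column.
Proof.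
move=> ix.
(* The cutoff is invisible to derivatives at points of the open chart image. *)
have pd_rho : nabla_w0 (conn_comp D i) (-2) (rho i) a x
    = nabla_w0 (conn_comp D i) (-2) (rho0 i) a x.
  by rewrite /nabla_w0 (pd_eq_on a (@im_open i) (@rho_in i) ix) rho_in.
have sym : forall y b c, sigma i y b c = sigma i y c b.
  by move=> y b c; exact: wsym2_entry_sym.
have vec b := prolonged_vec (@im_open i) (@D_smooth i) (@D_sym i) (@D_closed i)
  (@sigma_smooth i) sym (@mu_smooth i) (@metrizable i) n_gt1 a b ix.
have fn := prolonged_fun (@im_open i) (@D_smooth i) (@D_sym i) (@D_closed i)
  (@sigma_smooth i) sym (@mu_smooth i) (@metrizable i) n_gt1 a ix.
congr (_, _, _).
- apply/matrixP => b c; rewrite !mxE /= metrizable //; ring.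
- apply/rowP => b; rewrite !mxE /= rho_in // vec; ring.
- by rewrite /= pd_rho fn subrr.
Qed.

End ProlongedTractor.

(** * Tractors determined by their value at one special connection *)

Section Correspondence.
Context {R : realType} {n : nat} (M : oriented_manifold R n).
Variable P : projective_structure M.

Lemma special_proj_equiv (D D' : special_in P) : proj_equiv D D'.
Proof.
case: D D' => [D [PD sD]] [D' [PD' sD']] /=.
exact: (@proj_classP _ _ _ P D D' PD).1 PD'.
Qed.

(** A choice, but [proj_change_trace] determines its values on chart images. *)
Definition special_change (D D' : special_in P) : one_form M :=
  sval (cid (special_proj_equiv D D')).

Lemma special_changeP (D D' : special_in P) :
  proj_change D D' (special_change D D').
Proof. exact: svalP (cid (special_proj_equiv D D')). Qed.

Section Extension.
Variables (D : special_in P) (s : wsym2 M (-2)) (m : wvec M (-2)) (r : wfun M (-2)).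

Let rep (D' : special_in P) : triple M := changed_triple (special_change D D') s m r.

Let rep_change (D1 D2 : special_in P) (U : one_form M) : proj_change D1 D2 U ->
  triple_change U (rep D1) (rep D2).
Proof.
move=> ch; apply: triple_change_add; [|exact: changed_tripleP|exact: changed_tripleP].
move=> i x; apply: proj_change_trans; last exact: special_changeP.
  exact: special_changeP.
exact: ch.
Qed.

Definition tractor_of_triple : tractor P := Tractor rep_change.

(** The chosen 1-form from D to itself vanishes on chart images. *)
Lemma tractor_of_tripleE : tractor_of_triple D = (s, m, r).
Proof.
have U0 : forall i x, chart_im i x -> special_change D D i x = 0.
  by move=> i x; apply: proj_change_refl; exact: special_changeP.
apply: (triple_change_uniq (U := special_change D D) (t := (s, m, r))).
  exact: changed_tripleP.
move=> i x ix; rewrite U0 //; split=> // [b|].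
  by rewrite big1 ?addr0 // => c _; rewrite mxE mul0r.
rewrite big1 => [|b _]; last by rewrite mxE mul0r.
rewrite mulr0 addr0 big1 ?addr0 // => b _.
by rewrite big1 // => c _; rewrite mxE !mul0r.
Qed.

End Extension.

Lemma tractor_eq_at (D : special_in P) (t t' : tractor P) : t D = t' D -> t = t'.
Proof.
move=> tt'; apply: tractor_eq => D'.
have ch := special_changeP D D'.
apply: (triple_change_uniq (tractor_change t ch)).
by rewrite tt'; exact: tractor_change.
Qed.

(** The first two rows in the shape that determines mu and rho from sigma; the first is also the
    metrizability equation. *)
Lemma prolonged_equationE (D : special_in P) (t : tractor P) s m r :
  t D = (s, m, r) -> prolonged_equation D t ->
  forall i x, chart_im i x -> forall a,
  (forall b c, nabla_w2 (conn_comp D i) (-2) (s i) a b c x =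
     delta a b * m i x 0 c + delta a c * m i x 0 b) /\
  (forall b, delta a b * r i x = nabla_w1 (conn_comp D i) (-2) (m i) a b x
     + \sum_c schouten (conn_comp D i) a c x * s i x b c
     - n%:R^-1 * \sum_c \sum_d weyl (conn_comp D i) a c b d x * s i x c d).
Proof.
move=> tD H i x ix a; have := H i x ix a; rewrite tD => {}H.
have /matrixP H1 := congr1 (fun c : column => c.1.1) H.
have /rowP H2 := congr1 (fun c : column => c.1.2) H.
split=> [b c|b].
  have := H1 b c; rewrite !mxE /= => /eqP; rewrite mulr0 subr0 -addrA -opprD subr_eq0.
  by move/eqP.
have := H2 b; rewrite !mxE /= => e.
by apply/esym/eqP; rewrite -subr_eq0; apply/eqP; apply: etrans e; ring.
Qed.

End Correspondence.

Theorem theorem5p1 (R : realType) (n : nat) (hn : (2 <= n)%N)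
    (M : oriented_manifold R n) (P : projective_structure M)
    (D : special_in P) :
  set_bij [set t : tractor P | prolonged_equation D t]
          [set sigma : wsym2 M (-2)%R | metrizability_equation D sigma]
          (tractor_sigma D).
Proof.
split.
- move=> t /= pt; rewrite /tractor_sigma.
  case tD: (t D) => [[s m] r]; exists m => i x ix a b c.
  by have [-> _] := prolonged_equationE tD pt ix a.
- move=> t t'; rewrite !inE /= => pt pt'; rewrite /tractor_sigma.
  case tD: (t D) => [[s m] r]; case tD': (t' D) => [[s' m'] r'] ss'; subst s'.
  have mm' : m = m'.
    apply: wvec_eq => i x ix b.
    (* The diagonal entries a = b = c isolate 2 mu^b. *)
    have [H _] := prolonged_equationE tD pt ix b.
    have [H' _] := prolonged_equationE tD' pt' ix b.
    have := H b b; rewrite H' /delta eqxx !mul1r => e.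
    by apply/esym; lra.
  subst m'; apply: (tractor_eq_at (D := D)); rewrite tD tD'; congr (_, _, _).
  (* One diagonal entry of the second row isolates rho; [hn], read as 1 < n, provides the index
     1. *)
  apply: wfun_eq => i x ix; pose a : 'I_n := Ordinal hn.
  have [_ /(_ a)] := prolonged_equationE tD pt ix a.
  have [_ /(_ a)] := prolonged_equationE tD' pt' ix a.
  by rewrite /delta eqxx !mul1r => -> ->.
- move=> s /= [m ms].
  (* Speciality of D supplies the parallel volume form on which the gluing of rho rests. *)
  have [_ [e pe]] := svalP D.
  have E := tractor_of_tripleE D s m (prolonged_triple hn pe s m).2.
  exists (tractor_of_triple D s m (prolonged_triple hn pe s m).2).
    by move=> i x ix a; rewrite E; exact: (prolonged_tripleP hn pe ms).
  by rewrite /tractor_sigma E.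
Qed.
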